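(* Let $p$ be a prime, $n\ge1$ an integer, $0\le\beta<n$, $1<q<r<\infty$, $0<\delta<1$, $\min\{\alpha,\gamma\}>-n$, and suppose $$(\beta+\delta)-\frac{n+\alpha}{q}=-\frac{n+\gamma}{r}.$$ Let $q'$ be the conjugate exponent of $q$. There is a constant $C>0$ depending only on $p,n,\alpha,\beta,\gamma,\delta,q,r$ such that the following holds. Let $\Phi$ be a radial function on $\mathbb{Q}_p^n$, $\Phi(\mathbf{x})=\psi(|\mathbf{x}|_p)$ for $\mathbf{x}\ne\mathbf{0}$, let $b\in\Lambda_\delta(\mathbb{Q}_p^n)$, and suppose that $$K_{3,q}=C\Big(\int_0^\infty|\psi(t)|^{q'}\,t^{(q'-1)(n+\alpha)-\beta q'-1}\max(1,t^{-\delta q'})\,dt\Big)^{1/q'}$$ is finite. Then for every $f\in L^q(|\mathbf{x}|_p^\alpha,\mathbb{Q}_p^n)$, $$\|H^b_{\Phi,\beta}f\|_{L^{r,\infty}(|\mathbf{x}|_p^\gamma,\mathbb{Q}_p^n)}\le K_4\,\|f\|_{L^q(|\mathbf{x}|_p^\alpha,\mathbb{Q}_p^n)},\qquad K_4=K_{3,q}\Big(\frac{1-p^{-n}}{1-p^{-(n+\gamma)}}\Big)^{1/r}(1-p^{-n})\,\|b\|_{\Lambda_\delta(\mathbb{Q}_p^n)}.$$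
   Context: $\mathbb{Q}_p$ is the field of $p$-adic numbers with absolute value $|\cdot|_p$; on $\mathbb{Q}_p^n$ put $|\mathbf{x}|_p=\max_{1\le k\le n}|x_k|_p$. $d\mathbf{x}$ is Haar measure on $\mathbb{Q}_p^n$ normalized so that the unit ball $\{|\mathbf{x}|_p\le1\}$ has measure $1$. The $p$-adic fractional Hausdorff operator is $$H_{\Phi,\beta}f(\mathbf{x})=\int_{\mathbb{Q}_p^n}\frac{\Phi(\mathbf{x}|\mathbf{y}|_p)}{|\mathbf{y}|_p^{n-\beta}}f(\mathbf{y})\,d\mathbf{y},$$ where in $\mathbf{x}|\mathbf{y}|_p$ the number $|\mathbf{y}|_p$ is a power of $p$, regarded as an element of $\mathbb{Q}_p$ multiplying the vector $\mathbf{x}$ (so $\big|\mathbf{x}|\mathbf{y}|_p\big|_p=|\mathbf{x}|_p/|\mathbf{y}|_p$). Its commutator with $b$ is $H^b_{\Phi,\beta}(f)=bH_{\Phi,\beta}(f)-H_{\Phi,\beta}(bf)$. The homogeneous Lipschitz space $\Lambda_\delta(\mathbb{Q}_p^n)$ consists of functions $b$ on $\mathbb{Q}_p^n$ with $$\|b\|_{\Lambda_\delta(\mathbb{Q}_p^n)}=\sup_{\mathbf{x},\mathbf{h}\in\mathbb{Q}_p^n,\ \mathbf{h}\ne\mathbf{0}}\frac{|b(\mathbf{x}+\mathbf{h})-b(\mathbf{x})|}{|\mathbf{h}|_p^\delta}<\infty.$$ Convention for the integral over $(0,\infty)$ (ordinary Lebesgue integral): the complex-valued function $\psi$, given on $\{p^k:k\in\mathbb{Z}\}$,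 is extended to $(0,\infty)$ as a step function, $\psi(t)=\psi(p^k)$ for $p^k\le t<p^{k+1}$. For a weight $w\ge0$ on $\mathbb{Q}_p^n$, $$\|f\|_{L^q(w,\mathbb{Q}_p^n)}=\Big(\int_{\mathbb{Q}_p^n}|f(\mathbf{x})|^q w(\mathbf{x})\,d\mathbf{x}\Big)^{1/q},\qquad \|f\|_{L^{r,\infty}(w,\mathbb{Q}_p^n)}=\sup_{\lambda>0}\lambda\Big(\int_{\{\mathbf{x}:|f(\mathbf{x})|>\lambda\}}w(\mathbf{x})\,d\mathbf{x}\Big)^{1/r}.$$ *)

(* Defs.v *)
From HB Require Import structures.
From mathcomp Require Import all_boot all_order all_algebra.
From mathcomp Require Import generic_quotient ring_quotient.
From mathcomp Require Import all_classical all_reals all_analysis.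
From mathcomp Require Import complex ring lra.

Set Implicit Arguments.
Unset Strict Implicit.
Unset Printing Implicit Defensive.

Import Order.TTheory GRing.Theory Num.Theory.
Import numFieldNormedType.Exports.
Import Normc.

Local Open Scope classical_set_scope.
Local Open Scope ring_scope.

Section PadicAbsRat.
Variable p : nat.

Definition intpabs (m : int) : rat :=
  if m == 0 then 0 else (p%:R ^+ logn p `|m|)^-1.

Definition ratpabs (x : rat) : rat := intpabs (numq x) / intpabs (denq x).

Hypothesis pp : prime p.

Let p_gt0 : 0 < p%:R :> rat.
Proof. by rewrite ltr0n prime_gt0. Qed.

Lemma intpabs_ge0 m : 0 <= intpabs m.
Proof. by rewrite /intpabs; case: ifP => // _; rewrite invr_ge0 exprn_ge0 // ltW. Qed.

Lemma intpabs_eq0 m : (intpabs m == 0) = (m == 0).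
Proof.
rewrite /intpabs; case: (eqVneq m 0) => [_|m0]; first by rewrite eqxx.
by rewrite invr_eq0 expf_eq0 (gt_eqF p_gt0) andbF.
Qed.

Lemma intpabsM m n : intpabs (m * n) = intpabs m * intpabs n.
Proof.
rewrite /intpabs mulf_eq0; case: eqP => [_|/eqP m0] /=; first by rewrite mul0r.
case: eqP => [_|/eqP n0]; first by rewrite mulr0.
by rewrite abszM lognM ?absz_gt0 // exprD invfM mulrC.
Qed.

Lemma intpabsD m n : intpabs (m + n) <= Num.max (intpabs m) (intpabs n).
Proof.
have [->|m0] := eqVneq m 0; first by rewrite add0r le_max lexx orbT.
have [->|n0] := eqVneq n 0; first by rewrite addr0 le_max lexx.
have [->|s0] := eqVneq (m + n) 0.
  by rewrite le_max [X in X <= _]/intpabs eqxx intpabs_ge0.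
pose k := minn (logn p `|m|) (logn p `|n|).
have key : (k <= logn p `|(m + n)%R|)%N.
  have dv (a : int) : (k <= logn p `|a|)%N -> ((p ^ k)%N%:Z %| a)%Z.
    by move=> ka; rewrite dvdzE /= (dvdn_trans (dvdn_exp2l p ka)) // pfactor_dvdnn.
  rewrite -pfactor_dvdn ?absz_gt0 //.
  by have := rpredD (dv m (geq_minl _ _)) (dv n (geq_minr _ _)); rewrite dvdzE.
rewrite /intpabs (negPf m0) (negPf n0) (negPf s0).
have le_inv (a b : nat) : (a <= b)%N -> (p%:R ^+ b)^-1 <= (p%:R ^+ a)^-1 :> rat.
  move=> ab; rewrite lef_pV2 ?posrE ?exprn_gt0 //.
  by rewrite ler_weXn2l // ler1n prime_gt0.
rewrite le_max; move: key; rewrite /k geq_min => /orP[/le_inv->//|/le_inv->].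
by rewrite orbT.
Qed.

Lemma ratpabsE (a b : int) : b != 0 -> ratpabs (a%:Q / b%:Q) = intpabs a / intpabs b.
Proof.
move=> b0; set x := _ / _; rewrite /ratpabs.
have d0 := denq_neq0 x.
have : numq x * b = a * denq x.
  apply: (@intr_inj rat); rewrite !rmorphM /=.
  have bQ : b%:Q != 0 by rewrite intr_eq0.
  have dQ : (denq x)%:Q != 0 by rewrite intr_eq0.
  have : (numq x)%:Q / (denq x)%:Q = a%:Q / b%:Q by rewrite divq_num_den.
  by move/eqP; rewrite eqr_div // => /eqP.
move=> /(congr1 intpabs); rewrite !intpabsM => E.
by apply/eqP; rewrite eqr_div ?intpabs_eq0 //; apply/eqP.
Qed.

Lemma ratpabs_ge0 x : 0 <= ratpabs x.
Proof. by rewrite divr_ge0 ?intpabs_ge0. Qed.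

Lemma ratpabs_eq0 x : (ratpabs x == 0) = (x == 0).
Proof. by rewrite mulf_eq0 invr_eq0 !intpabs_eq0 (negPf (denq_neq0 x)) orbF numq_eq0. Qed.

Lemma ratpabs0 : ratpabs 0 = 0.
Proof. by apply/eqP; rewrite ratpabs_eq0. Qed.

Lemma ratpabsM x y : ratpabs (x * y) = ratpabs x * ratpabs y.
Proof.
rewrite -{1}(divq_num_den x) -{1}(divq_num_den y) mulf_div -!rmorphM /=.
by rewrite ratpabsE ?mulf_neq0 ?denq_neq0 // !intpabsM mulf_div.
Qed.

Lemma ratpabs1 : ratpabs 1 = 1.
Proof.
have h : ratpabs 1 != 0 by rewrite ratpabs_eq0 oner_eq0.
by apply: (mulfI h); rewrite -ratpabsM !mulr1.
Qed.

Lemma ratpabsV x : ratpabs x^-1 = (ratpabs x)^-1.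
Proof.
have [->|x0] := eqVneq x 0; first by rewrite invr0 ratpabs0 invr0.
have h : ratpabs x != 0 by rewrite ratpabs_eq0.
by apply: (mulfI h); rewrite -ratpabsM !divff // ratpabs1.
Qed.

Lemma ratpabsN x : ratpabs (- x) = ratpabs x.
Proof. by rewrite /ratpabs numqN denqN /intpabs oppr_eq0 abszN. Qed.

Lemma ratpabsD x y : ratpabs (x + y) <= Num.max (ratpabs x) (ratpabs y).
Proof.
have dx := denq_neq0 x; have dy := denq_neq0 y.
have dQ (z : rat) : (denq z)%:Q != 0 by rewrite intr_eq0 denq_neq0.
have xE : x = (numq x * denq y)%:~R / (denq x * denq y)%:~R.
  by rewrite !rmorphM /= -mulf_div divff // mulr1 divq_num_den.
have yE : y = (denq x * numq y)%:~R / (denq x * denq y)%:~R.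
  by rewrite !rmorphM /= -mulf_div divff // mul1r divq_num_den.
have key (a b d : int) : d != 0 ->
    ratpabs (a%:~R / d%:~R + b%:~R / d%:~R) <=
    Num.max (ratpabs (a%:~R / d%:~R)) (ratpabs (b%:~R / d%:~R)).
  move=> d0; rewrite -mulrDl -rmorphD !ratpabsE // -maxr_pMl ?invr_ge0 ?intpabs_ge0 //.
  by rewrite ler_wpM2r ?invr_ge0 ?intpabs_ge0 // intpabsD.
have := key (numq x * denq y) (denq x * numq y) (denq x * denq y).
by rewrite -xE -yE; apply; rewrite mulf_neq0.
Qed.

Lemma ratpabsB x y : ratpabs (x - y) <= Num.max (ratpabs x) (ratpabs y).
Proof. by rewrite -[ratpabs y]ratpabsN ratpabsD. Qed.

Lemma ratpabs_distC x y : ratpabs (x - y) = ratpabs (y - x).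
Proof. by rewrite -ratpabsN opprB. Qed.

Lemma ratpabs_p : ratpabs p%:R = p%:R^-1.
Proof.
have p0 : (p%:Z == 0) = false by apply/negbTE; rewrite -lt0n prime_gt0.
rewrite -[p%:R]divr1 (@ratpabsE p 1) // /intpabs p0 /=.
have -> : logn p `|p| = 1%N by rewrite logn_prime // eqxx.
by rewrite logn1 expr0 invr1 !mulr1 expr1.
Qed.

Lemma ratpabs_pow x : x != 0 -> exists k : int, ratpabs x = p%:R ^ k.
Proof.
move=> x0; exists ((logn p `|denq x|)%:Z - (logn p `|numq x|)%:Z).
rewrite expfzDr ?gt_eqF // -exprnP -exprnN mulrC.
by rewrite /ratpabs /intpabs numq_eq0 (negPf x0) (negPf (denq_neq0 x)) invrK.
Qed.

End PadicAbsRat.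

Lemma ratpabs_isosceles p (pp : prime p) x y :
  ratpabs p (x - y) < ratpabs p y -> ratpabs p x = ratpabs p y.
Proof.
move=> xy; apply/eqP; rewrite eq_le; apply/andP; split.
  rewrite -{1}(subrK y x) (le_trans (ratpabsD pp _ _)) // ge_max lexx andbT.
  exact: ltW.
have : ratpabs p y <= Num.max (ratpabs p x) (ratpabs p (x - y)).
  by rewrite -{1}(subKr x y) ratpabsB.
by rewrite le_max => /orP[//|]; rewrite leNgt xy.
Qed.

Section PadicField.
Variables (p : nat) (pp : prime p).

Local Notation abs := (ratpabs p).

Definition padic_cauchy : {pred (nat -> rat)} := fun u =>
  `[< forall e : rat, 0 < e ->
      exists N, forall m n, (N <= m)%N -> (N <= n)%N -> abs (u m - u n) < e >].

Lemma padic_cauchyP u : reflect (forall e : rat, 0 < e ->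
    exists N, forall m n, (N <= m)%N -> (N <= n)%N -> abs (u m - u n) < e)
  (u \in padic_cauchy).
Proof. exact: asboolP. Qed.

Lemma padic_cauchy_bounded u : u \in padic_cauchy ->
  exists2 B : rat, 0 < B & exists N, forall n, (N <= n)%N -> abs (u n) <= B.
Proof.
move=> /padic_cauchyP /(_ 1 ltr01)[N uN].
exists (Num.max 1 (abs (u N))); first by rewrite lt_max ltr01.
exists N => n Nn; rewrite -(subrK (u N) (u n)) (le_trans (ratpabsD pp _ _)) //.
by rewrite ge_max !le_max (ltW (uN _ _ Nn (leqnn _))) lexx orbT.
Qed.

Lemma padic_cauchy_subring : subring_closed padic_cauchy.
Proof.
split.
- by apply/padic_cauchyP => e e0; exists 0%N => m n _ _; rewrite subrr ratpabs0.
- move=> u v /padic_cauchyP uC /padic_cauchyP vC; apply/padic_cauchyP => e e0.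
  have [N uN] := uC e e0; have [M vM] := vC e e0.
  exists (maxn N M) => m n; rewrite !geq_max => /andP[Nm Mm] /andP[Nn Mn].
  have -> : (u - v) m - (u - v) n = (u m - u n) - (v m - v n).
    by rewrite !fctE; ring.
  by rewrite (le_lt_trans (ratpabsB pp _ _)) // gt_max uN ?vM.
- move=> u v uC vC; have [A A0 [N1 uA]] := padic_cauchy_bounded uC.
  have [B B0 [N2 vB]] := padic_cauchy_bounded vC.
  move: uC vC => /padic_cauchyP uC /padic_cauchyP vC; apply/padic_cauchyP => e e0.
  have [N uN] := uC (e / B) (divr_gt0 e0 B0).
  have [M vM] := vC (e / A) (divr_gt0 e0 A0).
  exists (maxn (maxn N1 N2) (maxn N M)) => m n.
  rewrite !geq_max -!andbA => /and4P[N1m N2m Nm Mm] /and4P[N1n N2n Nn Mn].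
  have -> : (u * v) m - (u * v) n = u m * (v m - v n) + v n * (u m - u n).
    by rewrite !fctE; ring.
  rewrite (le_lt_trans (ratpabsD pp _ _)) // gt_max !ratpabsM //; apply/andP; split.
    rewrite (le_lt_trans (ler_wpM2r (ratpabs_ge0 p _) (uA _ N1m))) //.
    by rewrite mulrC -ltr_pdivlMr ?vM.
  rewrite (le_lt_trans (ler_wpM2r (ratpabs_ge0 p _) (vB _ N2n))) //.
  by rewrite mulrC -ltr_pdivlMr ?uN.
Qed.

HB.instance Definition _ :=
  GRing.isSubringClosed.Build (nat -> rat) padic_cauchy padic_cauchy_subring.

Record cauchy_seq := CauchySeq {
  cauchy_val :> nat -> rat;
  cauchy_valP : cauchy_val \in padic_cauchy }.

HB.instance Definition _ := [isSub for cauchy_val].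
HB.instance Definition _ := [Choice of cauchy_seq by <:].
HB.instance Definition _ := [SubChoice_isSubComNzRing of cauchy_seq by <:].

Definition padic_null : {pred cauchy_seq} := fun u =>
  `[< forall e : rat, 0 < e -> exists N, forall n, (N <= n)%N -> abs (u n) < e >].

Lemma padic_nullP (u : cauchy_seq) : reflect (forall e : rat, 0 < e ->
    exists N, forall n, (N <= n)%N -> abs (u n) < e) (u \in padic_null).
Proof. exact: asboolP. Qed.

Lemma padic_null_ideal : idealr_closed padic_null.
Proof.
split.
- by apply/padic_nullP => e e0; exists 0%N => n _; rewrite ratpabs0.
- apply/padic_nullP => /(_ 1 ltr01)[N /(_ N (leqnn _))].
  by rewrite ratpabs1 // ltxx.
- move=> u v w /padic_nullP vC /padic_nullP wC; apply/padic_nullP => e e0.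
  have [A A0 [N uA]] := padic_cauchy_bounded (cauchy_valP u).
  have [M vM] := vC (e / A) (divr_gt0 e0 A0).
  have [K wK] := wC e e0.
  exists (maxn N (maxn M K)) => n; rewrite !geq_max => /and3P[Nn Mn Kn].
  rewrite [X in abs X](_ : _ = u n * v n + w n) //.
  rewrite (le_lt_trans (ratpabsD pp _ _)) // gt_max wK // andbT ratpabsM //.
  rewrite (le_lt_trans (ler_wpM2r (ratpabs_ge0 p _) (uA _ Nn))) //.
  by rewrite mulrC -ltr_pdivlMr ?vM.
Qed.

HB.instance Definition _ := isIdealr.Build cauchy_seq padic_null padic_null_ideal.

(* Q_p is the completion of Q for ratpabs: Cauchy sequences modulo null
   sequences.  The absolute value padic_abs below is rational-valued, so that
   [ratr] sends it both into the reals and into Q_p; padic_abs_ratr,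
   padic_abs_rat_dense and padic_abs_complete characterize the completion. *)
Definition Qp : Type := {ideal_quot padic_null}.
HB.instance Definition _ := GRing.ComNzRing.on Qp.


Definition Qp_of (u : cauchy_seq) : Qp := \pi_(Qp)%qT u.

Lemma Qp_ofK (x : Qp) : exists u, x = Qp_of u.
Proof. by exists (repr x); rewrite /Qp_of reprK. Qed.

Lemma Qp_of_eq u v : (Qp_of u == Qp_of v) = (u - v \in padic_null).
Proof. by rewrite Quotient.idealrBE. Qed.

Lemma Qp_of_eq0 u : (Qp_of u == 0) = (u \in padic_null).
Proof. by rewrite -[0](rmorph0 (\pi_Qp)%qT) Qp_of_eq subr0. Qed.

Lemma Qp_ofB u v : Qp_of (u - v) = Qp_of u - Qp_of v.
Proof. exact: rmorphB. Qed.

Lemma Qp_ofD u v : Qp_of (u + v) = Qp_of u + Qp_of v.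
Proof. exact: rmorphD. Qed.

Lemma Qp_ofM u v : Qp_of (u * v) = Qp_of u * Qp_of v.
Proof. exact: rmorphM. Qed.

Lemma padic_nonnull (u : cauchy_seq) : u \notin padic_null ->
  exists2 c : rat, 0 < c & exists N, forall n, (N <= n)%N -> abs (u n) = c.
Proof.
move=> /padic_nullP /existsNP[e /not_implyP[e0 /forallNP ue]].
have /padic_cauchyP /(_ e e0)[N uN] := cauchy_valP u.
have /existsNP[m /not_implyP[Nm /negP um]] := ue N.
rewrite -leNgt in um; exists (abs (u m)); first exact: lt_le_trans um.
by exists N => n Nn; apply: ratpabs_isosceles => //; exact: lt_le_trans (uN _ _ Nn Nm) um.
Qed.

Lemma padic_cauchyV (u : cauchy_seq) : u \notin padic_null ->
  (fun n => (u n)^-1) \in padic_cauchy.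
Proof.
move=> /padic_nonnull[c c0 [N uN]]; apply/padic_cauchyP => e e0.
have /padic_cauchyP /(_ (e * (c * c)))[|M uM] := cauchy_valP u.
  by rewrite !mulr_gt0.
exists (maxn N M) => m n; rewrite !geq_max => /andP[Nm Mm] /andP[Nn Mn].
have nz k : (N <= k)%N -> u k != 0.
  by move=> Nk; rewrite -(ratpabs_eq0 pp) uN // gt_eqF.
have -> : (u m)^-1 - (u n)^-1 = (u n - u m) / (u m * u n).
  by field; rewrite !nz.
by rewrite ratpabsM // ratpabsV // ratpabsM // !uN // ltr_pdivrMr ?mulr_gt0 ?uM.
Qed.

Definition Qp_inv (x : Qp) : Qp := xget 0 [set y | y * x = 1].

Lemma Qp_mulVf (x : Qp) : x != 0 -> Qp_inv x * x = 1.
Proof.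
have [u ->] := Qp_ofK x; rewrite Qp_of_eq0 => u0.
pose v := CauchySeq (padic_cauchyV u0).
have [c c0 [N uN]] := padic_nonnull u0.
rewrite /Qp_inv; case: xgetP => [y _ //|/(_ (Qp_of v)) []] /=.
rewrite -Qp_ofM -[1](rmorph1 (\pi_Qp)%qT); apply/eqP.
rewrite Qp_of_eq; apply/padic_nullP => e e0; exists N => n Nn.
rewrite [X in abs X](_ : _ = (u n)^-1 * u n - 1) //.
by rewrite mulVf ?subrr ?ratpabs0 // -(ratpabs_eq0 pp) uN // gt_eqF.
Qed.

Lemma Qp_inv0 : Qp_inv 0 = 0.
Proof.
rewrite /Qp_inv; case: xgetP => // y _ /= /eqP.
by rewrite mulr0 eq_sym oner_eq0.
Qed.

HB.instance Definition _ := GRing.ComNzRing_isField.Build Qp Qp_mulVf Qp_inv0.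
HB.instance Definition _ := isPointed.Build Qp 0.


Definition ratpabs_lim (u : nat -> rat) (c : rat) :=
  forall e : rat, 0 < e -> exists N, forall n, (N <= n)%N -> `|abs (u n) - c| < e.

(* |x|_p is the limit of |u_n|_p for any Cauchy sequence u representing x. *)
Definition padic_abs (x : Qp) : rat :=
  xget 0 [set c | exists2 u : cauchy_seq, Qp_of u = x & ratpabs_lim u c].

Lemma ratpabs_lim_const u c :
  (exists N, forall n, (N <= n)%N -> abs (u n) = c) -> ratpabs_lim u c.
Proof. by move=> [N uN] e e0; exists N => n Nn; rewrite uN // subrr normr0. Qed.

Lemma ratpabs_lim_null (u : cauchy_seq) : u \in padic_null -> ratpabs_lim u 0.
Proof.
move=> /padic_nullP uN e /uN[N {}uN]; exists N => n /uN.
by rewrite subr0 ger0_norm // ratpabs_ge0.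
Qed.

Lemma ratpabs_dist x y : `|abs x - abs y| <= abs (x - y).
Proof.
wlog xy : x y / abs y <= abs x.
  move=> H; case/orP: (le_total (abs x) (abs y)) => h; last exact: H.
  by rewrite distrC ratpabs_distC // H.
rewrite ger0_norm ?subr_ge0 //; case: (ltP (abs (x - y)) (abs y)) => h.
  by rewrite (ratpabs_isosceles pp h) subrr ratpabs_ge0.
have : abs x <= Num.max (abs (x - y)) (abs y) by rewrite -{1}(subrK y x) ratpabsD.
rewrite (max_idPl h) => xxy; rewrite (le_trans _ xxy) //.
by rewrite lerBlDr lerDl ratpabs_ge0.
Qed.

Lemma ratpabs_lim_uniq (u v : cauchy_seq) c d : Qp_of u = Qp_of v ->
  ratpabs_lim u c -> ratpabs_lim v d -> c = d.
Proof.
move=> /eqP; rewrite Qp_of_eq => /padic_nullP uv uc vd.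
apply/eqP/negPn/negP => cd.
have e0 : 0 < `|c - d| / 3 by rewrite divr_gt0 // normr_gt0 subr_eq0.
have [N1 h1] := uv _ e0; have [N2 h2] := uc _ e0; have [N3 h3] := vd _ e0.
pose n := maxn N1 (maxn N2 N3).
have {}h1 : abs (u n - v n) < `|c - d| / 3 by apply: h1; rewrite leq_maxl.
have {}h2 := h2 n; have {}h3 := h3 n.
have {h2} h2 : `|abs (u n) - c| < `|c - d| / 3 by apply: h2; rewrite !leq_max leqnn orbT.
have {h3} h3 : `|abs (v n) - d| < `|c - d| / 3 by apply: h3; rewrite !leq_max leqnn !orbT.
have := ratpabs_dist (u n) (v n).
have : `|c - d| <= `|abs (u n) - c| + `|abs (u n) - abs (v n)| + `|abs (v n) - d|.
  have -> : c - d = (c - abs (u n)) + (abs (u n) - abs (v n)) + (abs (v n) - d) by ring.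
  rewrite (le_trans (ler_normD _ _)) // lerD2r (le_trans (ler_normD _ _)) //.
  by rewrite lerD2r distrC.
by lra.
Qed.

Lemma padic_absE (u : cauchy_seq) c : ratpabs_lim u c -> padic_abs (Qp_of u) = c.
Proof.
move=> uc; rewrite /padic_abs; case: xgetP => [d _ [v vu vd]|/(_ c) []].
  exact: ratpabs_lim_uniq vu vd uc.
by exists u.
Qed.

Lemma padic_abs_ex (u : cauchy_seq) : ratpabs_lim u (padic_abs (Qp_of u)).
Proof.
have [u0|/padic_nonnull[c _ uc]] := boolP (u \in padic_null).
  by rewrite (padic_absE (ratpabs_lim_null u0)); exact: ratpabs_lim_null.
by rewrite (padic_absE (ratpabs_lim_const uc)); exact: ratpabs_lim_const.
Qed.

Lemma padic_abs0 : padic_abs 0 = 0.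
Proof.
have -> : 0 = Qp_of 0 by rewrite /Qp_of rmorph0.
by apply/padic_absE/ratpabs_lim_null; rewrite rpred0.
Qed.

Lemma padic_abs_ev x : x != 0 -> exists (u : cauchy_seq) c, [/\ x = Qp_of u, 0 < c,
  padic_abs x = c & exists N, forall n, (N <= n)%N -> abs (u n) = c].
Proof.
have [u ->] := Qp_ofK x; rewrite Qp_of_eq0 => /padic_nonnull[c c0 uc].
by exists u, c; split => //; exact/padic_absE/ratpabs_lim_const.
Qed.

Lemma padic_abs_eq0 x : (padic_abs x == 0) = (x == 0).
Proof.
have [->|x0] := eqVneq x 0; first by rewrite padic_abs0 eqxx.
by have [u [c [_ c0 -> _]]] := padic_abs_ev x0; rewrite gt_eqF.
Qed.

Lemma padic_abs_ge0 x : 0 <= padic_abs x.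
Proof.
have [->|x0] := eqVneq x 0; first by rewrite padic_abs0.
by have [u [c [_ c0 -> _]]] := padic_abs_ev x0; exact: ltW.
Qed.

Lemma padic_absM x y : padic_abs (x * y) = padic_abs x * padic_abs y.
Proof.
have [->|x0] := eqVneq x 0; first by rewrite !(mul0r, padic_abs0).
have [->|y0] := eqVneq y 0; first by rewrite !(mulr0, padic_abs0).
have [u [c [-> c0 -> [N uN]]]] := padic_abs_ev x0.
have [v [d [-> d0 -> [M vM]]]] := padic_abs_ev y0.
rewrite -Qp_ofM; apply/padic_absE/ratpabs_lim_const.
exists (maxn N M) => n; rewrite geq_max => /andP[Nn Mn].
by rewrite [X in abs X](_ : _ = u n * v n) // ratpabsM // uN ?vM.
Qed.

Lemma padic_absD x y : padic_abs (x + y) <= Num.max (padic_abs x) (padic_abs y).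
Proof.
have [->|x0] := eqVneq x 0; first by rewrite add0r le_max lexx orbT.
have [->|y0] := eqVneq y 0; first by rewrite addr0 le_max lexx.
have [u [c [-> c0 -> [N uN]]]] := padic_abs_ev x0.
have [v [d [-> d0 -> [M vM]]]] := padic_abs_ev y0.
have [->|xy0] := eqVneq (Qp_of u + Qp_of v) 0.
  by rewrite padic_abs0 le_max (ltW c0).
move: xy0; rewrite -Qp_ofD Qp_of_eq0 => /padic_nonnull[e _ [K wK]].
have -> : padic_abs (Qp_of (u + v)) = e.
  by apply/padic_absE/ratpabs_lim_const; exists K.
pose n := maxn K (maxn N M).
rewrite -(wK n) ?leq_maxl // -(uN n) ?leq_max ?leqnn ?orbT //.
by rewrite -(vM n) ?leq_max ?leqnn ?orbT // ratpabsD.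
Qed.

Lemma padic_const_cauchy (r : rat) : (fun _ : nat => r) \in padic_cauchy.
Proof. by apply/padic_cauchyP => e e0; exists 0%N => m n _ _; rewrite subrr ratpabs0. Qed.

Definition padic_const (r : rat) : cauchy_seq := CauchySeq (padic_const_cauchy r).
Definition Qp_rat (r : rat) : Qp := Qp_of (padic_const r).

Lemma Qp_rat_zmod : zmod_morphism Qp_rat.
Proof. by move=> x y; rewrite /Qp_rat -Qp_ofB; congr Qp_of; exact: val_inj. Qed.

Lemma Qp_rat_monoid : monoid_morphism Qp_rat.
Proof.
split; first by rewrite /Qp_rat -[RHS](rmorph1 (\pi_Qp)%qT); congr Qp_of; exact: val_inj.
by move=> x y; rewrite /Qp_rat -Qp_ofM; congr Qp_of; exact: val_inj.
Qed.

HB.instance Definition _ := GRing.isZmodMorphism.Build rat Qp Qp_rat Qp_rat_zmod.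
HB.instance Definition _ := GRing.isMonoidMorphism.Build rat Qp Qp_rat Qp_rat_monoid.

Lemma Qp_ratE r : Qp_rat r = ratr r.
Proof. by rewrite -(fmorph_rat Qp_rat) /ratr divq_num_den. Qed.

Lemma padic_abs_ratr r : padic_abs (ratr r) = abs r.
Proof. by rewrite -Qp_ratE; apply/padic_absE/ratpabs_lim_const; exists 0%N. Qed.

Lemma padic_abs_pow x : x != 0 -> exists k : int, padic_abs x = p%:R ^ k.
Proof.
move=> /padic_abs_ev[u [c [_ c0 -> [N /(_ N (leqnn N)) uN]]]].
by rewrite -uN; apply: ratpabs_pow => //; rewrite -(ratpabs_eq0 pp) uN gt_eqF.
Qed.

Lemma padic_absN x : padic_abs (- x) = padic_abs x.
Proof.
have N1 : -1 = Qp_rat (-1) by rewrite rmorphN1.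
by rewrite -mulN1r padic_absM {1}N1 Qp_ratE padic_abs_ratr
   ratpabsN // ratpabs1 // mul1r.
Qed.

Lemma padic_abs_rat_dense x e : 0 < e -> exists r : rat, padic_abs (x - ratr r) < e.
Proof.
move=> e0; have [u ->] := Qp_ofK x.
have e2 : 0 < e / 2 by rewrite divr_gt0.
have /padic_cauchyP /(_ _ e2)[N uN] := cauchy_valP u.
exists (u N); rewrite -Qp_ratE -Qp_ofB.
have [M /(_ (maxn N M) (leq_maxr _ _)) h] := padic_abs_ex (u - padic_const (u N)) e2.
have := uN _ _ (leq_maxl N M) (leqnn _).
move: h; set a := abs _; set b := padic_abs _.
by rewrite ltr_norml -/a => /andP[h _] h'; move: (h') h; rewrite -/a; lra.
Qed.

Lemma padic_abs_complete (X : nat -> Qp) :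
  (forall e, 0 < e -> exists N, forall m n, (N <= m)%N -> (N <= n)%N ->
     padic_abs (X m - X n) < e) ->
  exists l, forall e, 0 < e -> exists N, forall n, (N <= n)%N ->
     padic_abs (X n - l) < e.
Proof.
move=> XC.
have inv0 (k : nat) : 0 < k.+1%:R^-1 :> rat by rewrite invr_gt0 ltr0n.
have [r rX] := choice (fun k => padic_abs_rat_dense (X k) (inv0 k)).
have small (e : rat) : 0 < e -> exists N, forall n, (N <= n)%N ->
    padic_abs (X n - ratr (r n)) < e.
  move=> e0; have [N eN] : exists N : nat, e^-1 < N.+1%:R.
    exists (Num.bound e^-1); rewrite (lt_trans (archi_boundP _)) ?invr_ge0 ?ltW //.
    by rewrite ltr_nat.
  exists N => n Nn; apply: lt_trans (rX n) _.
  rewrite -[e]invrK ltf_pV2 ?posrE ?invr_gt0 ?ltr0n //.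
  by rewrite (lt_le_trans eN) // ler_nat.
have rC : r \in padic_cauchy.
  apply/padic_cauchyP => e e0; have [N1 h1] := XC e e0; have [N2 h2] := small e e0.
  exists (maxn N1 N2) => m n; rewrite !geq_max => /andP[N1m N2m] /andP[N1n N2n].
  rewrite -padic_abs_ratr; have -> : ratr (r m - r n) = ratr (r m) - ratr (r n) :> Qp.
    by rewrite -!Qp_ratE; exact: rmorphB.
  have -> : ratr (r m) - ratr (r n) =
    (X m - X n) + (- (X m - ratr (r m)) + (X n - ratr (r n))) :> Qp by ring.
  rewrite (le_lt_trans (padic_absD _ _)) // gt_max h1 //=.
  by rewrite (le_lt_trans (padic_absD _ _)) // gt_max padic_absN !h2.
exists (Qp_of (CauchySeq rC)) => e e0.
have [N1 h1] := small e e0.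
have e2 : 0 < e / 2 by rewrite divr_gt0.
have /padic_cauchyP /(_ _ e2)[N2 h2] := rC.
exists (maxn N1 N2) => n; rewrite geq_max => /andP[N1n N2n].
have -> : X n - Qp_of (CauchySeq rC) =
  (X n - ratr (r n)) + (Qp_rat (r n) - Qp_of (CauchySeq rC)).
  by rewrite -Qp_ratE; ring.
rewrite (le_lt_trans (padic_absD _ _)) // gt_max h1 //= -Qp_ofB.
have [M /(_ (maxn N2 M) (leq_maxr _ _)) h] :=
  padic_abs_ex (padic_const (r n) - CauchySeq rC) e2.
have := h2 _ _ N2n (leq_maxl N2 M).
move: h; set a := abs _; set b := padic_abs _.
by rewrite ltr_norml -/a => /andP[h _] h'; move: (h') h; rewrite -/a; lra.
Qed.

End PadicField.

Section PadicSpace.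
Variables (p : nat) (pp : prime p) (n : nat).

Definition pnorm (x : 'rV[Qp pp]_n) : rat :=
  \big[Num.max/0]_(k < n) padic_abs (x 0 k).

Definition Qpn_open : set (set 'rV[Qp pp]_n) :=
  [set U | forall x, U x ->
    exists2 e : rat, 0 < e & forall y, pnorm (y - x) < e -> U y].

End PadicSpace.

(* Q_p^n with its Borel sigma-algebra; as a type it is 'rV[Qp pp]_n. *)
Notation Qpn pp n := (g_sigma_algebraType (@Qpn_open _ pp n)).

Section PadicAnalysis.
Variables (R : realType) (p : nat) (pp : prime p) (n : nat).

Local Notation V := 'rV[Qp pp]_n.

Definition rnorm (x : V) : R := ratr (pnorm x).

Definition pow_weight (a : R) (x : V) : R := rnorm x `^ a.

(* Local finiteness is implied by the normalization; on this separable locally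
   compact group such a Borel measure is the Haar measure. *)
Definition normalized_haar (mu : {measure set (Qpn pp n) -> \bar R}) : Prop :=
  mu [set x | pnorm x <= 1] = 1%E /\
  forall (a : V) (A : set V), measurable (A : set (Qpn pp n)) ->
    mu [set a + x | x in A] = mu A.

Definition lip_norm (delta : R) (b : V -> R[i]) : \bar R :=
  ereal_sup [set e | exists x h : V, h != 0 /\
    e = (normc (b (x + h) - b x) / rnorm h `^ delta)%:E].

Definition lip_space (delta : R) (b : V -> R[i]) : Prop :=
  (lip_norm delta b < +oo)%E.

Definition cmeasurable (f : V -> R[i]) : Prop :=
  measurable_fun setT ((fun x => complex.Re (f x)) : Qpn pp n -> R) /\
  measurable_fun setT ((fun x => complex.Im (f x)) : Qpn pp n -> R).

Section WithMeasure.
Variable mu : {measure set (Qpn pp n) -> \bar R}.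

(* Meaningful only when f is integrable: \int is totalized by [fine]. *)
Definition cintegral (f : V -> R[i]) : R[i] :=
  Complex (\int[mu]_(x in setT) complex.Re (f x))
          (\int[mu]_(x in setT) complex.Im (f x)).

(* [ratr (pnorm y)] is the rational number |y|_p viewed in Q_p. *)
Definition hausdorff_op (Phi : V -> R[i]) (beta : R) (f : V -> R[i]) (x : V)
    : R[i] :=
  cintegral (fun y => Phi (ratr (pnorm y) *: x) /
                      real_complex R (rnorm y `^ (n%:R - beta)) * f y).

Definition hausdorff_comm (Phi : V -> R[i]) (beta : R) (b f : V -> R[i])
    (x : V) : R[i] :=
  b x * hausdorff_op Phi beta f x - hausdorff_op Phi beta (fun y => b y * f y) x.

Definition wLq_norm (q : R) (w : V -> R) (f : V -> R[i]) : \bar R :=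
  poweR (\int[mu]_x (normc (f x) `^ q * w x)%:E)%E q^-1.

Definition wLq (q : R) (w : V -> R) (f : V -> R[i]) : Prop :=
  cmeasurable f /\ (wLq_norm q w f < +oo)%E.

Definition weak_wLr_norm (r : R) (w : V -> R) (f : V -> R[i]) : \bar R :=
  ereal_sup [set e | exists2 l : R, 0 < l &
    e = (l%:E * poweR (\int[mu]_(x in [set y : V | (l < normc (f y))%R]) (w x)%:E) r^-1)%E].

End WithMeasure.

End PadicAnalysis.

(* Only the values of psi on ]0, +oo[ are ever used. *)
Definition padic_step (R : realType) (p : nat) (psi : R -> R[i]) : Prop :=
  forall (k : int) (t : R), p%:R ^ k <= t < p%:R ^ (k + 1) ->
    psi t = psi (p%:R ^ k).

Definition K3 (R : realType) (n : nat) (alpha beta delta q' C : R)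
    (psi : R -> R[i]) : \bar R :=
  (C%:E * poweR (\int[lebesgue_measure]_(t in `]0%R, +oo[)
     (normc (psi t) `^ q' * t `^ ((q' - 1) * (n%:R + alpha) - beta * q' - 1) *
      Num.max 1 (t `^ (- (delta * q'))))%:E) q'^-1)%E.

Definition K4 (R : realType) (p n : nat) (pp : prime p)
    (alpha beta gamma delta r q' C : R) (psi : R -> R[i])
    (b : 'rV[Qp pp]_n -> R[i]) : \bar R :=
  (K3 n alpha beta delta q' C psi *
   (((1 - p%:R `^ (- n%:R)) / (1 - p%:R `^ (- (n%:R + gamma)))) `^ r^-1 *
    (1 - p%:R `^ (- n%:R)))%:E *
   lip_norm delta b)%E.

(* Main.v *)
Require Import Defs.
From HB Require Import structures.
From mathcomp Require Import all_boot all_order all_algebra.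
From mathcomp Require Import all_classical all_reals all_analysis.
From mathcomp Require Import measurable_realfun.
From mathcomp Require Import complex ring lra zify.

Set Implicit Arguments.
Unset Strict Implicit.
Unset Printing Implicit Defensive.

Import Order.TTheory GRing.Theory Num.Theory.
Import numFieldNormedType.Exports.
Import Normc.

Local Open Scope classical_set_scope.
Local Open Scope ring_scope.

(** The commutator is an integral operator with kernel
    [(b x - b y) Phi (x |y|) / |y| ^ (n - beta)]. A Lipschitz [b] satisfies
    [|b x - b y| <= L max (|x|, |y|) ^ delta], and Hoelder's inequality, with the
    weight [|y| ^ alpha] put on [f], bounds the operator by the norm of [f] times
    the [L ^ q'] norm of a kernel that depends on [|x|] and [|y|] only. In the
    variable [t = |x| / |y|] that norm is homogeneous in [|x|] of degree
    [(beta + delta) - (n + alpha) / q], so that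
      [|H x| <= M |x| ^ (- (n + gamma) / r)]
    by the balance condition ([normc_commutator_le]). A power of this degree lies
    in weak [L ^ r] for the weight [|x| ^ gamma]: its level sets are balls, whose
    weight is a geometric series ([weak_wLr_norm_le]).

    The coefficient of the homogeneous power is a sum over the spheres
    [|y| = |x| / p ^ j], while the theorem speaks of an integral over the
    half-line. On [p ^ j <= t < p ^ (j + 1)] the function [psi] is constant and
    the powers of [t] vary by bounded factors, so the two are compared term by
    term ([integral_weighted_kernel_le], through [ge0_integral_partition_le]);
    the factors lost there are the constant [C].

    The Haar measure enters only through the measure of spheres
    ([haar_psphere]), which follows from the decomposition of a ball into [p ^ n]
    translates of the next smaller one ([haar_pballS]), and through the
    nullity of the origin. Measurability comes for free: the norm takes countably
    many values on measurable level sets, so every function of [|y|] is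
    measurable, and Lipschitz functions are continuous. *)

(** * Powers of a real base *)

Section RealPowers.
Variable R : realType.
Implicit Types a s t : R.

Lemma powRD_gt0 a s t : 0 < a -> a `^ (s + t) = a `^ s * a `^ t.
Proof. by move=> a0; rewrite powRD // (gt_eqF a0) implybT. Qed.

Lemma ltr_powR a s t : 1 < a -> (a `^ s < a `^ t) = (s < t).
Proof.
move=> a1; have a0 : 0 < a by exact: lt_trans a1.
by rewrite /powR gt_eqF // ltr_expR ltr_pM2r // ln_gt0.
Qed.

Lemma subr_powR_gt0 a s : 1 < a -> s < 0 -> 0 < 1 - a `^ s.
Proof. by move=> a1 s0; rewrite subr_gt0 -(powRr0 a) ltr_powR. Qed.

Lemma powR_bracket (a t : R) : 1 < a -> 0 < t ->
  exists k : int, a `^ k%:~R <= t < a `^ (k + 1)%:~R.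
Proof.
move=> a1 t0; have a0 : 0 < a by exact: lt_trans a1.
have la : 0 < ln a by rewrite ln_gt0.
have /andP[h1 h2] := floor_itv (ln t / ln a).
exists (Num.floor (ln t / ln a)); rewrite /powR gt_eqF //.
rewrite -[t in _ <= t](lnK t0) -[t in t < _](lnK t0) ler_expR ltr_expR.
by rewrite -ler_pdivlMr // h1 -ltr_pdivrMr // h2.
Qed.

(** The power [t `^ u] is least at the left end of the bracket when [0 <= u] and
    at the right end otherwise; the loss [`|u|] covers both cases. *)
Lemma powR_bracket_ge (a j u t : R) : 1 < a -> a `^ j <= t < a `^ (j + 1) ->
  a `^ (j * u - `|u|) <= t `^ u.
Proof.
move=> a1 /andP[jt tj]; have a0 : 0 < a by exact: lt_trans a1.
have t0 : 0 < t by apply: lt_le_trans jt; rewrite powR_gt0.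
have [u0|u0] := leP 0 u.
  apply: (@le_trans _ _ ((a `^ j) `^ u)).
    rewrite -powRrM; apply: ler_powR; first exact: ltW.
    by rewrite gerBl.
  by rewrite ge0_ler_powR ?nnegrE ?powR_ge0 // ltW.
rewrite ltr0_norm // (_ : j * u - - u = (j + 1) * u); last by ring.
rewrite powRrM -[u]opprK !(powRN _ (- u)) lef_pV2 ?posrE ?powR_gt0 //.
by rewrite ge0_ler_powR ?nnegrE ?powR_ge0 ?oppr_ge0 // ltW.
Qed.

(** For [t = a ^ j] the maximum is [a ^ (max 0 (- j) * w)]; moving [t] up to
    [a ^ (j + 1)] costs at most the factor [a ^ w]. *)
Lemma max_bracket_ge (a w t : R) (j : int) : 1 < a -> 0 <= w ->
  a `^ j%:~R <= t < a `^ (j + 1)%:~R ->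
  a `^ (Num.max 0 (- j%:~R) * w - w) <= Num.max 1 (t `^ (- w)).
Proof.
move=> a1 w0 jt; have a0 : 0 < a by exact: lt_trans a1.
rewrite le_max; have [j0|j0] := leP 0 j.
  apply/orP; left; rewrite max_l; last by rewrite oppr_le0 ler0z.
  rewrite mul0r sub0r powRN invf_le1 ?powR_gt0 //.
  by rewrite -(powRr0 a); apply: ler_powR => //; exact: ltW.
apply/orP; right; rewrite max_r; last by rewrite oppr_ge0 lerz0 ltW.
rewrite -{2}[w]ger0_norm // -[`|w|]normrN mulNr -mulrN.
by apply: powR_bracket_ge => //; move: jt; rewrite intrD.
Qed.

End RealPowers.

(** * The norm and the leading digits of a p-adic vector *)

Section PnormTheory.
Variables (p : nat) (pp : prime p) (n : nat).
Implicit Types x y z : 'rV[Qp pp]_n.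

Let p_gt0 : 0 < p%:R :> rat.
Proof. by rewrite ltr0n prime_gt0. Qed.

Lemma padic_abs_ratr_pow (k : int) :
  padic_abs (ratr (p%:R ^ k) : Qp pp) = p%:R ^ (- k).
Proof.
have expn m : ratpabs p (p%:R ^+ m) = p%:R ^- m.
  elim: m => [|m IH]; first by rewrite !expr0 ratpabs1 // invr1.
  by rewrite !exprS ratpabsM // IH ratpabs_p // invfM.
rewrite padic_abs_ratr; case: k => m; first by rewrite -exprnP expn exprnN.
by rewrite NegzE -exprnN ratpabsV // expn invrK opprK -exprnP.
Qed.

Lemma padic_abs1 : padic_abs (1 : Qp pp) = 1.
Proof.
have -> : 1 = ratr 1 :> Qp pp by rewrite -Qp_ratE rmorph1.
by rewrite padic_abs_ratr ratpabs1.
Qed.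

Lemma pnorm_ge0 x : 0 <= pnorm x.
Proof.
by rewrite /pnorm; elim/big_rec: _ => // k c _ c0; rewrite le_max c0 orbT.
Qed.

Lemma padic_abs_le_pnorm x k : padic_abs (x 0 k) <= pnorm x.
Proof. exact: le_bigmax_cond. Qed.

Lemma pnorm_leP x (c : rat) : 0 <= c ->
  reflect (forall k, padic_abs (x 0 k) <= c) (pnorm x <= c).
Proof.
move=> c0; apply: (iffP idP) => [xc k|xc].
  exact: le_trans (padic_abs_le_pnorm x k) xc.
exact: bigmax_le.
Qed.

Lemma pnorm0 : pnorm (0 : 'rV[Qp pp]_n) = 0.
Proof.
apply/le_anti; rewrite pnorm_ge0 andbT; apply/pnorm_leP => // k.
by rewrite mxE padic_abs0.
Qed.

Lemma pnorm_eq0 x : (pnorm x == 0) = (x == 0).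
Proof.
apply/idP/idP => [/eqP x0|/eqP->]; last by rewrite pnorm0.
apply/eqP/rowP => k; rewrite mxE; apply/eqP; rewrite -padic_abs_eq0 eq_le.
by rewrite padic_abs_ge0 andbT -x0 padic_abs_le_pnorm.
Qed.

Lemma pnorm_gt0 x : (0 < pnorm x) = (x != 0).
Proof. by rewrite lt_neqAle pnorm_ge0 andbT eq_sym pnorm_eq0. Qed.

Lemma pnormD x y : pnorm (x + y) <= Num.max (pnorm x) (pnorm y).
Proof.
apply/pnorm_leP => [|k]; first by rewrite le_max pnorm_ge0.
rewrite mxE (le_trans (padic_absD _ _)) // ge_max !le_max.
by rewrite !padic_abs_le_pnorm orbT.
Qed.

Lemma pnormN x : pnorm (- x) = pnorm x.
Proof. by apply: eq_bigr => k _; rewrite mxE padic_absN. Qed.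

Lemma pnormB x y : pnorm (x - y) <= Num.max (pnorm x) (pnorm y).
Proof. by rewrite (le_trans (pnormD _ _)) // pnormN. Qed.

Lemma pnorm_distC x y : pnorm (x - y) = pnorm (y - x).
Proof. by rewrite -pnormN opprB. Qed.

Lemma pnormZ (a : Qp pp) x : pnorm (a *: x) = padic_abs a * pnorm x.
Proof.
have [->|a0] := eqVneq a 0; first by rewrite scale0r pnorm0 padic_abs0 mul0r.
have le_pnormZ (c : Qp pp) z : pnorm (c *: z) <= padic_abs c * pnorm z.
  apply/pnorm_leP => [|k]; first by rewrite mulr_ge0 ?padic_abs_ge0 ?pnorm_ge0.
  by rewrite mxE padic_absM ler_wpM2l ?padic_abs_ge0 ?padic_abs_le_pnorm.
apply/le_anti; rewrite le_pnormZ /=.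
have aa : padic_abs a * padic_abs a^-1 = 1.
  by rewrite -padic_absM divff // padic_abs1.
have h : pnorm x <= padic_abs a^-1 * pnorm (a *: x).
  by rewrite -{1}[x]scale1r -(mulVf a0) -scalerA le_pnormZ.
have := ler_wpM2l (padic_abs_ge0 a) h.
by rewrite mulrA aa mul1r.
Qed.

(** The ultrametric inequality makes every vector closer to [x] than [0] is
    have the norm of [x]; hence nonzero level sets of the norm are open. *)
Lemma pnorm_isosceles x y : pnorm (y - x) < pnorm x -> pnorm y = pnorm x.
Proof.
move=> yx; apply/le_anti/andP; split.
  by rewrite -{1}(subrK x y) (le_trans (pnormD _ _)) // ge_max lexx (ltW yx).
have : pnorm x <= Num.max (pnorm y) (pnorm (y - x)).
  by rewrite -{1}(subKr y x) pnormB.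
by rewrite le_max => /orP[//|]; rewrite leNgt yx.
Qed.

Lemma pnorm_pow x : x != 0 -> exists k : int, pnorm x = p%:R ^ k.
Proof.
move=> x0; have [k xk] : exists k, pnorm x = padic_abs (x 0 k).
  have : pnorm x != 0 by rewrite pnorm_eq0.
  rewrite /pnorm; elim/big_rec: _ => [/eqP//|k c _ IH].
  rewrite maxEle; case: ifP => _ h; last by exists k.
  exact: IH.
have : x 0 k != 0 by rewrite -padic_abs_eq0 -xk pnorm_eq0.
by move=> /padic_abs_pow[j xj]; exists j; rewrite xk.
Qed.

Lemma ler_pexpz (k l : int) : (p%:R ^ k <= p%:R ^ l :> rat) = (k <= l).
Proof. by rewrite ler_eXz2l // ltr1n prime_gt1. Qed.

Lemma pexpz_inj : injective (fun k : int => p%:R ^ k : rat).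
Proof. by move=> k l /eqP; rewrite eq_le !ler_pexpz -eq_le => /eqP. Qed.

(** The residue field has [p] elements: approximate [x] by a rational number,
    whose denominator is then prime to [p], and reduce it modulo [p]. *)
Lemma padic_digit (a : Qp pp) : padic_abs a <= 1 ->
  exists i : 'I_p, padic_abs (a - i%:R) <= p%:R^-1.
Proof.
move=> a1; have pV0 : 0 < p%:R^-1 :> rat by rewrite invr_gt0.
have [r ar] := padic_abs_rat_dense a pV0.
have pV1 : p%:R^-1 < 1 :> rat by rewrite invf_lt1 // ltr1n prime_gt1.
have r1 : ratpabs p r <= 1.
  rewrite -(padic_abs_ratr pp) -[ratr r](subKr a).
  rewrite (le_trans (padic_absD _ _)) // ge_max a1 padic_absN /=.
  exact/ltW/(lt_trans ar).
(* An integral [r] in lowest terms has no factor [p] in its denominator. *)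
have den_p : ~~ (p %| `|denq r|)%N.
  apply/negP => pd; have np : ~~ (p %| `|numq r|)%N.
    apply/negP => pn; have := coprime_num_den r; rewrite /coprime => /eqP cg.
    have : (p %| 1)%N by rewrite -cg dvdn_gcd pn pd.
    by rewrite dvdn1 => /eqP p1; move: pp; rewrite p1.
  have n0 : numq r != 0 by apply: contraNneq np => ->; rewrite dvdn0.
  move: r1; rewrite /ratpabs /intpabs (negPf n0) (negPf (denq_neq0 r)) invrK.
  rewrite lognE (negPf np) !andbF expr0 invr1 mul1r leNgt => /negP; apply.
  rewrite exprn_egt1 ?ltr1n ?prime_gt1 // -lt0n logn_gt0 mem_primes pp pd.
  by rewrite absz_gt0 denq_neq0.
(* [v] inverts the denominator modulo [p], so [i] is the residue of [r]. *)
have [u [v uv]] : exists u v : int, u * p%:Z + v * denq r = 1.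
  have := Bezoutz p%:Z (denq r) => -[u [v uv]]; exists u, v; rewrite uv.
  by rewrite /gcdz /=; congr Posz; apply/eqP; rewrite -/(coprime _ _) prime_coprime.
have p0 : (p%:Z != 0) by rewrite -lt0n prime_gt0.
pose i := ((numq r * v) %% p%:Z)%Z.
have i0 : 0 <= i by rewrite modz_ge0.
have ip : (`|i| < p)%N.
  by rewrite -ltz_nat gez0_abs // ltz_pmod // ltz_nat prime_gt0.
exists (Ordinal ip) => /=.
have iE : (`|i|%N)%:R = ratr (i%:~R) :> Qp pp.
  by rewrite ratr_int -{2}(gez0_abs i0) -pmulrn.
have ri : ratpabs p (r - i%:~R) <= p%:R^-1.
  have d0 : (denq r)%:~R != 0 :> rat by rewrite intr_eq0 denq_neq0.
  have -> : r - i%:~R = (numq r - i * denq r)%:~R / (denq r)%:~R.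
    by rewrite intrB intrM mulrBl mulfK // divq_num_den.
  rewrite ratpabsE ?denq_neq0 // {2}/intpabs (negPf (denq_neq0 r)).
  rewrite (@lognE p `|denq r|) (negPf den_p) !andbF expr0 invr1 divr1 /intpabs.
  case: ifPn => [_|w0]; first exact: ltW.
  rewrite lef_pV2 ?posrE ?exprn_gt0 // -{1}[p%:R]expr1.
  apply: ler_weXn2l; first by rewrite ler1n prime_gt0.
  rewrite logn_gt0 mem_primes pp absz_gt0 w0 /=.
  have : (p%:Z %| numq r - i * denq r)%Z.
    apply/dvdzP; exists (numq r * u + ((numq r * v) %/ p%:Z)%Z * denq r).
    have key (w P N D j : int) : N * v = w * P + j -> u * P + v * D = 1 ->
        N - j * D = (N * u + w * D) * P.
      move=> ej e1; have -> : j = N * v - w * P by rewrite ej; ring.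
      by rewrite -{1}[N]mulr1 -e1; ring.
    exact: key (divz_eq _ _) uv.
  by rewrite dvdzE.
rewrite iE -(subrKA (ratr r)) (le_trans (padic_absD _ _)) // ge_max (ltW ar) /=.
have -> : ratr r - ratr i%:~R = ratr (r - i%:~R) :> Qp pp.
  by rewrite -!Qp_ratE; symmetry; exact: rmorphB.
by rewrite padic_abs_ratr.
Qed.

(** Two distinct digits differ by a nonzero integer smaller than [p], which is a
    p-adic unit. *)
Lemma padic_digit_dist (i j : 'I_p) : i != j ->
  padic_abs (i%:R - j%:R : Qp pp) = 1.
Proof.
move=> ij; have -> : i%:R - j%:R = ratr (i%:Z - j%:Z)%:~R :> Qp pp.
  by rewrite ratr_int rmorphB /= -!pmulrn.
rewrite padic_abs_ratr -[_%:~R]divr1 (@ratpabsE p pp _ 1) //.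
have w0 : i%:Z - j%:Z != 0.
  by apply: contra ij; rewrite subr_eq0 eqz_nat => /eqP/val_inj->.
rewrite /intpabs (negPf w0) /= logn1 expr0 invr1 divr1.
have -> : logn p `|i%:Z - j%:Z| = 0%N; last by rewrite expr0 invr1.
apply/eqP; rewrite -leqn0 leqNgt logn_gt0 mem_primes pp absz_gt0 w0 /=.
apply/negP => /dvdn_leq; rewrite absz_gt0 w0 => /(_ isT).
by have := ltn_ord i; have := ltn_ord j; lia.
Qed.

End PnormTheory.

(** * Balls, spheres and their Haar measure *)

Section HaarMeasure.
Variables (R : realType) (p : nat) (pp : prime p) (n : nat).
Local Notation V := 'rV[Qp pp]_n.

Definition pball (k : int) : set (Qpn pp n) := [set x | pnorm x <= p%:R ^ k].
Definition psphere (k : int) : set (Qpn pp n) := [set x | pnorm x = p%:R ^ k].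

Let pexpz_gt0 (k : int) : 0 < p%:R ^ k :> rat.
Proof. by rewrite exprz_gt0 // ltr0n prime_gt0. Qed.

Lemma measurable_Qpn_open (U : set (Qpn pp n)) : Qpn_open U -> measurable U.
Proof. by move=> oU; exact: sub_sigma_algebra. Qed.

(** Spheres around the origin are open by [pnorm_isosceles], and so is the
    complement of the origin. *)
Lemma measurable_pnorm_eq (c : rat) :
  measurable ([set x | pnorm x = c] : set (Qpn pp n)).
Proof.
have [->|c0] := eqVneq c 0.
  rewrite -[X in measurable X]setCK; apply: measurableC.
  apply: measurable_Qpn_open => x /= /eqP x0.
  exists (pnorm x); first by rewrite lt_neqAle eq_sym x0 pnorm_ge0.
  by move=> y /pnorm_isosceles->; exact/eqP.
apply: measurable_Qpn_open => x /= xc; exists (pnorm x).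
  by rewrite lt_neqAle pnorm_ge0 xc eq_sym c0.
by move=> y /pnorm_isosceles->.
Qed.

(** The norm takes countably many values, on measurable level sets; hence [g] is
    arbitrary. *)
Lemma measurable_radial d (T : measurableType d) (g : rat -> T) :
  measurable_fun setT ((fun y => g (pnorm y)) : Qpn pp n -> T).
Proof.
move=> _ Y _; rewrite setTI.
have -> : (fun y : V => g (pnorm y)) @^-1` Y =
    \bigcup_(c : rat) (if g c \in Y then [set y | pnorm y = c] else set0).
  apply/seteqP; split => [y Yy|y [c _]] /=.
    by exists (pnorm y) => //; rewrite mem_set.
  by case: ifPn => // gY /= ->; rewrite -in_setE.
apply: bigcupT_measurable_rat => c; case: ifP => _ //.
exact: measurable_pnorm_eq.
Qed.

Lemma measurable_zero_set : measurable ([set 0 : V] : set (Qpn pp n)).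
Proof.
rewrite (_ : [set 0] = [set x : V | pnorm x = 0]).
  exact: measurable_pnorm_eq.
apply/seteqP; split => x /=; first by move=> ->; exact: pnorm0.
by move=> /eqP; rewrite pnorm_eq0 => /eqP.
Qed.

Lemma measurable_pball k : measurable (pball k).
Proof.
apply: measurable_Qpn_open => x xk; exists (p%:R ^ k) => // y yx.
rewrite /pball /= -(subrK x y) (le_trans (pnormD _ _)) //.
by rewrite ge_max xk (ltW yx).
Qed.

Lemma measurable_psphere k : measurable (psphere k).
Proof. exact: measurable_pnorm_eq. Qed.

Lemma psphereE k : psphere k = pball k `\` pball (k - 1).
Proof.
apply/seteqP; split => x; rewrite /psphere /pball /=.
  by move=> ->; split=> //; apply/negP; rewrite ler_pexpz //; lia.
move=> [xk /negP xk1]; have [x0|x0] := eqVneq x 0.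
  by move: xk1; rewrite x0 pnorm0 (ltW (pexpz_gt0 _)).
have [j xj] := pnorm_pow x0; move: xk xk1; rewrite xj !ler_pexpz // => *.
by congr (_ ^ _); lia.
Qed.

Variable mu : {measure set (Qpn pp n) -> \bar R}.
Hypothesis mu_haar : normalized_haar mu.

(** A ball is the disjoint union of [p ^ n] translates of the next smaller one,
    indexed by the leading digits of the coordinates. *)
Lemma haar_pballS k : mu (pball (k + 1)) = ((p ^ n)%N%:R%:E * mu (pball k))%E.
Proof.
pose a (d : {ffun 'I_n -> 'I_p}) : V :=
  \row_j (ratr (p%:R ^ (- (k + 1))) * (d j)%:R).
pose B d : set (Qpn pp n) := [set a d + x | x in pball k].
have BE d x : B d x <-> pnorm (x - a d) <= p%:R ^ k.
  split => [[y yk <-]|h]; first by rewrite addrC addKr.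
  by exists (x - a d) => //; rewrite addrC subrK.
have mB d : measurable (B d).
  apply: measurable_Qpn_open => x /BE xd; exists (p%:R ^ k) => // y yx.
  apply/BE; rewrite -(subrKA x) (le_trans (pnormD _ _)) //.
  by rewrite ge_max xd (ltW yx).
have muB d : mu (B d) = mu (pball k).
  by case: mu_haar => _; apply; exact: measurable_pball.
have kk : p%:R ^ (k + 1) * p%:R^-1 = p%:R ^ k :> rat.
  by rewrite expfzDr ?mulfK // pnatr_eq0 -lt0n prime_gt0.
have abs_pk : padic_abs (ratr (p%:R ^ (- (k + 1))) : Qp pp) = p%:R ^ (k + 1).
  by rewrite padic_abs_ratr_pow // opprK.
(* After rescaling [x] by [p ^ (k + 1)], its leading digits are those of an
   element of the unit ball. *)
have UB : pball (k + 1) = \bigcup_(d in [set: {ffun 'I_n -> 'I_p}]) B d.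
  apply/seteqP; split => [x xk|x [d _ /BE xd]].
    have dig j : exists i : 'I_p,
        padic_abs (x 0 j * ratr (p%:R ^ (k + 1)) - i%:R) <= p%:R^-1.
      apply: padic_digit; rewrite padic_absM padic_abs_ratr_pow //.
      rewrite -invr_expz ler_pdivrMr // mul1r.
      exact: le_trans (padic_abs_le_pnorm _ _) xk.
    have [d dP] := choice dig.
    exists [ffun j => d j] => //; apply/BE/pnorm_leP => [|j]; first exact: ltW.
    rewrite !mxE ffunE -kk.
    have -> : x 0 j - ratr (p%:R ^ (- (k + 1))) * (d j)%:R =
        ratr (p%:R ^ (- (k + 1))) * (x 0 j * ratr (p%:R ^ (k + 1)) - (d j)%:R).
      rewrite mulrBr; congr (_ - _); rewrite mulrCA -!Qp_ratE -rmorphM /=.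
      rewrite -expfzDr ?addNr ?expr0z ?rmorph1 ?mulr1 //.
      by rewrite pnatr_eq0 -lt0n prime_gt0.
    by rewrite padic_absM abs_pk ler_wpM2l // ltW.
  rewrite /pball /= -(subrK (a d) x) (le_trans (pnormD _ _)) // ge_max.
  apply/andP; split; first by rewrite (le_trans xd) // ler_pexpz //; lia.
  apply/pnorm_leP => [|j]; first exact: ltW.
  rewrite mxE padic_absM abs_pk ler_piMr //; first exact: ltW.
  have -> : (d j)%:R = ratr (Posz (d j))%:~R :> Qp pp.
    by rewrite ratr_int -pmulrn.
  rewrite padic_abs_ratr -[_%:~R]divr1 (@ratpabsE p pp _ 1) // /intpabs /=.
  rewrite logn1 expr0 invr1 divr1; case: ifP => // _.
  by rewrite invf_le1 ?exprn_gt0 ?ltr0n ?prime_gt0 // exprn_ege1 // ler1n prime_gt0.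
rewrite UB measure_fin_bigcup //; [|exact: finite_finset|]; last first.
  move=> d d' _ _ [x [/BE xd /BE xd']]; apply/eqP/negPn/negP => dd'.
  have [j] : exists j, d j != d' j.
    apply: contrapT => /forallNP h; move: dd'; rewrite (_ : d = d') ?eqxx //.
    by apply/ffunP => j; have /negP := h j; rewrite negbK => /eqP.
  move=> djj; have : pnorm (a d - a d') <= p%:R ^ k.
    rewrite -(subrKA x) (le_trans (pnormD _ _)) // ge_max xd'.
    by rewrite pnorm_distC xd.
  move/pnorm_leP => /(_ (ltW (pexpz_gt0 _)) j); rewrite !mxE -mulrBr padic_absM.
  rewrite abs_pk padic_digit_dist // mulr1 ler_pexpz //; lia.
have -> : [set: {ffun 'I_n -> 'I_p}] = [set` predT] by apply/seteqP; split.
rewrite -(@bigfs _ _ _ _ (index_enum _)) ?index_enum_uniq //;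
  last by move=> d _; rewrite mem_index_enum.
rewrite (eq_bigr (fun=> mu (pball k))); last by move=> d _; exact: muB.
by rewrite sumr_const card_ffun !card_ord mule_natl.
Qed.

Lemma haar_pball k : mu (pball k) = ((p%:R `^ n%:R) `^ k%:~R)%:E.
Proof.
have p0 : 0 < p%:R :> R by rewrite ltr0n prime_gt0.
have pn0 : p%:R `^ n%:R > 0 :> R by rewrite powR_gt0.
have pnE : (p ^ n)%N%:R = p%:R `^ n%:R :> R by rewrite powR_mulrn ?ltW // natrX.
have step j : mu (pball (j + 1)) = ((p%:R `^ n%:R)%:E * mu (pball j))%E.
  by rewrite haar_pballS pnE.
have m0 : mu (pball 0) = 1%E by case: mu_haar => + _; rewrite /pball expr0z.
have powS (j : int) : p%:R `^ n%:R * (p%:R `^ n%:R) `^ j%:~R =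
    (p%:R `^ n%:R) `^ (j + 1)%:~R :> R.
  by rewrite intrD powRD_gt0 // powRr1 ?(ltW pn0) // mulrC.
elim/int_rec: k => [|k IH|k IH].
- by rewrite [mu _]m0 [_%:~R]mulr0z powRr0.
- have -> : k.+1%:Z = k%:Z + 1 by lia.
  by rewrite step IH -EFinM powS.
(* Downwards, the recurrence is solved for the smaller ball. *)
- have := step (- k.+1%:Z).
  have -> : - k.+1%:Z + 1 = - k%:Z by lia.
  rewrite IH => e; have : ((p%:R `^ n%:R)%:E * mu (pball (- k.+1%:Z)) =
      (p%:R `^ n%:R)%:E * ((p%:R `^ n%:R) `^ (- k.+1%:Z)%:~R)%:E)%E.
    by rewrite -e -EFinM powS; congr (_ `^ _%:~R)%:E; lia.
  move/(congr1 (fun z => ((p%:R `^ n%:R)^-1%:E * z)%E)).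
  by rewrite !muleA -EFinM mulVf ?gt_eqF // !mul1e.
Qed.

Lemma haar_psphere k :
  mu (psphere k) = ((1 - p%:R `^ (- n%:R)) * p%:R `^ (k%:~R * n%:R))%:E.
Proof.
have p0 : 0 < p%:R :> R by rewrite ltr0n prime_gt0.
rewrite psphereE measureD; [|exact: measurable_pball..|].
  rewrite setIidr; last first.
    by move=> x h; rewrite /pball /= (le_trans h) // ler_pexpz //; lia.
  transitivity (mu (pball k) - mu (pball (k - 1)))%E; first by [].
  rewrite !haar_pball -EFinB; congr EFin.
  rewrite -!powRrM [n%:R * _]mulrC [n%:R * _]mulrC intrB.
  rewrite mulrBl mul1r powRD_gt0 //; ring.
by rewrite [X in (X < _)%E](_ : _ = mu (pball k)) // haar_pball ltry.
Qed.

(** The origin lies in arbitrarily small balls. *)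
Lemma haar_set0 : (0 < n)%N -> mu [set 0 : V] = 0%E.
Proof.
move=> n0; set O := [set _]; apply/eqP; rewrite eq_le measure_ge0 andbT.
have small (k : nat) : (mu O <= ((p%:R `^ (- n%:R)) ^+ k)%:E)%E.
  apply: (@le_trans _ _ (mu (pball (- k%:Z)))).
    apply: le_measure; rewrite ?inE //; first exact: measurable_zero_set.
      exact: measurable_pball.
    by move=> x /= ->; rewrite /pball /= pnorm0 ltW.
  rewrite haar_pball lee_fin -powR_mulrn ?powR_ge0 // -!powRrM.
  by rewrite mulrNz mulrN mulNr.
have z1 : `|p%:R `^ (- n%:R)| < 1 :> R.
  rewrite ger0_norm ?powR_ge0 // -subr_gt0 subr_powR_gt0 //.
    by rewrite ltr1n prime_gt1.
  by rewrite oppr_lt0 ltr0n.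
have fin : mu O \is a fin_num.
  by rewrite ge0_fin_numE // (le_lt_trans (small 0%N)) // ltry.
rewrite -(fineK fin) lee_fin.
apply: (cvgr_to_ge (cvg_expr z1)); apply: nearW => k.
by rewrite -lee_fin fineK.
Qed.

End HaarMeasure.

(** * Integrals over countable partitions *)

Section Integration.

(** Countable additivity is about sequences of sets: [pickle_inv] lists [I]
    without repetition, and the numbers that encode no element of [I] are given
    the empty set. *)
Definition pickled_family (I : countType) T (E : I -> set T) (k : nat) : set T :=
  if pickle_inv k is Some i then E i else set0.

Lemma bigcup_pickled (I : countType) T (E : I -> set T) :
  \bigcup_i E i = \bigcup_k pickled_family E k.
Proof.
apply/seteqP; split => x [k _ Ek].
  by exists (pickle k) => //; rewrite /pickled_family pickleK_inv.
by move: Ek; rewrite /pickled_family; case: pickle_inv => // i Ei; exists i.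
Qed.

Lemma trivIset_pickled (I : countType) T (E : I -> set T) :
  trivIset setT E -> trivIset setT (pickled_family E).
Proof.
move=> tE k l _ _; rewrite /pickled_family.
case kE: (pickle_inv k) => [i|] [x []] // xk.
case lE: (pickle_inv l) => [j|] // xl.
have ij : i = j by apply: tE => //; exists x.
have := @pickle_invK I k; have := @pickle_invK I l.
by rewrite kE lE /= ij => -> ->.
Qed.

Lemma measurable_pickled (I : countType) d (T : measurableType d)
    (E : I -> set T) k :
  (forall i, measurable (E i)) -> measurable (pickled_family E k).
Proof. by move=> mE; rewrite /pickled_family; case: pickle_inv. Qed.

(** Comparing two integrals piece by piece replaces the exact evaluation of
    either of them as a series. *)
Lemma ge0_integral_partition_le (R : realType) (I : countType)
    d (T : measurableType d) (mu : {measure set T -> \bar R})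
    d' (T' : measurableType d') (nu : {measure set T' -> \bar R})
    (E : I -> set T) (E' : I -> set T') (f : T -> \bar R) (g : T' -> \bar R)
    (c : R) :
  (forall i, measurable (E i)) -> (forall i, measurable (E' i)) ->
  trivIset setT E -> trivIset setT E' ->
  measurable_fun (\bigcup_i E i) f -> measurable_fun (\bigcup_i E' i) g ->
  (forall x, 0 <= f x)%E -> (forall x, 0 <= g x)%E ->
  (forall i, \int[mu]_(x in E i) f x <= c%:E * \int[nu]_(x in E' i) g x)%E ->
  (\int[mu]_(x in \bigcup_i E i) f x <=
   c%:E * \int[nu]_(x in \bigcup_i E' i) g x)%E.
Proof.
move=> mE mE' tE tE' + + f0 g0 fg.
rewrite (bigcup_pickled E) (bigcup_pickled E') => mf mg.
rewrite !ge0_integral_bigcup //; try exact: trivIset_pickled;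
  try (by move=> k; exact: measurable_pickled).
rewrite -nneseriesZl; last by move=> k _; exact: integral_ge0.
apply: lee_nneseries => [k _ _|k _]; first exact: integral_ge0.
by rewrite /pickled_family; case: pickle_inv => // ; rewrite !integral_set0 mule0.
Qed.

Lemma measurable_fun_bigcup_countable (I : countType) d (T : measurableType d)
    d' (T' : measurableType d') (E : I -> set T) (f : T -> T') :
  (forall i, measurable (E i)) -> (forall i, measurable_fun (E i) f) ->
  measurable_fun (\bigcup_i E i) f.
Proof.
move=> mE mf; rewrite (bigcup_pickled E); apply/measurable_fun_bigcup => k.
  exact: measurable_pickled.
rewrite /pickled_family; case: pickle_inv => // _; exact: measurable_fun_set0.
Qed.

(** Nonnegative integrals are monotone in their domain, whether or not the
    smaller domain is measurable: every simple function below the smaller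
    integrand is below the larger one. *)
Lemma ge0_subset_integral_gen (R : realType) d (T : measurableType d)
    (nu : {measure set T -> \bar R}) (A B : set T) (f : T -> \bar R) :
  A `<=` B -> (forall x, 0 <= f x)%E ->
  (\int[nu]_(x in A) f x <= \int[nu]_(x in B) f x)%E.
Proof.
move=> AB f0; rewrite integral_mkcond [leRHS]integral_mkcond.
have p0 D x : (0 <= (f \_ D) x)%E by rewrite patchE; case: ifP.
rewrite !ge0_integralTE //; apply: ereal_sup_le => _ [h hf <-].
exists h => // x; apply: le_trans (hf x) _; rewrite !patchE.
case: ifPn => [/set_mem/AB/mem_set->//|_]; case: ifP => // _; exact: f0.
Qed.

End Integration.

(** * Integrals of complex functions *)

Section ComplexIntegral.
Variables (R : realType) (p : nat) (pp : prime p) (n : nat).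
Local Notation V := 'rV[Qp pp]_n.
Variable mu : {measure set (Qpn pp n) -> \bar R}.

Definition cintegrable (f : V -> R[i]) : Prop :=
  mu.-integrable setT (EFin \o (fun x => complex.Re (f x))) /\
  mu.-integrable setT (EFin \o (fun x => complex.Im (f x))).

Lemma normc_sqrtE (z : R[i]) :
  normc z = Num.sqrt (complex.Re z ^+ 2 + complex.Im z ^+ 2).
Proof. by case: z. Qed.

Lemma normc_ge0 (z : R[i]) : 0 <= normc z.
Proof. by rewrite normc_sqrtE sqrtr_ge0. Qed.

Lemma normr_Re_le (z : R[i]) : `|complex.Re z| <= normc z.
Proof.
by rewrite normc_sqrtE -sqrtr_sqr ler_sqrt ?lerDl ?sqr_ge0 ?addr_ge0 ?sqr_ge0.
Qed.

Lemma normr_Im_le (z : R[i]) : `|complex.Im z| <= normc z.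
Proof.
by rewrite normc_sqrtE -sqrtr_sqr ler_sqrt ?lerDr ?sqr_ge0 ?addr_ge0 ?sqr_ge0.
Qed.

Lemma cmeasurableM (f g : V -> R[i]) :
  cmeasurable f -> cmeasurable g -> cmeasurable (fun x => f x * g x).
Proof.
move=> [fR fI] [gR gI]; split.
- rewrite (_ : (fun x => _) = (fun x => complex.Re (f x) * complex.Re (g x) -
      complex.Im (f x) * complex.Im (g x))); last first.
    by apply/funext => x; case: (f x); case: (g x).
  by apply: measurable_funB; apply: measurable_funM.
- rewrite (_ : (fun x => _) = (fun x => complex.Re (f x) * complex.Im (g x) +
      complex.Im (f x) * complex.Re (g x))); last first.
    by apply/funext => x; case: (f x); case: (g x).
  by apply: measurable_funD; apply: measurable_funM.
Qed.

Lemma measurable_normc (f : V -> R[i]) : cmeasurable f ->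
  measurable_fun setT ((fun x => normc (f x)) : Qpn pp n -> R).
Proof.
move=> [fR fI].
rewrite (_ : (fun x => _) = (fun x => (complex.Re (f x) ^+ 2 +
    complex.Im (f x) ^+ 2) `^ 2^-1)); last first.
  apply/funext => x; rewrite normc_sqrtE powR12_sqrt //.
  by rewrite addr_ge0 ?sqr_ge0.
apply: (measurableT_comp (measurable_powR 2^-1)).
by apply: measurable_funD; apply: measurable_funX.
Qed.

Lemma le_cintegrable (f : V -> R[i]) (h : Qpn pp n -> R) : cmeasurable f ->
  mu.-integrable setT (EFin \o h) -> (forall x, normc (f x) <= h x) ->
  cintegrable f.
Proof.
move=> [mR mI] ih fh; split; apply: le_integrable ih => //;
  try exact/measurable_EFinP; move=> x _ /=; rewrite lee_fin.
  by rewrite (le_trans (normr_Re_le _)) // (le_trans (fh x)) // ler_norm.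
by rewrite (le_trans (normr_Im_le _)) // (le_trans (fh x)) // ler_norm.
Qed.

(** Rotating the value of the integral to the positive real axis turns the
    triangle inequality into the monotonicity of a real integral:
    [|I| ^+ 2 = \int (Re I * Re f + Im I * Im f)], and Cauchy-Schwarz bounds
    the integrand by [|I| * |f|]. *)
Lemma normc_cintegral_le (f : V -> R[i]) (h : Qpn pp n -> R) :
  cintegrable f -> mu.-integrable setT (EFin \o h) ->
  (forall x, normc (f x) <= h x) ->
  normc (cintegral mu f) <= \int[mu]_(x in setT) h x.
Proof.
have cs (w z : R[i]) : complex.Re w * complex.Re z + complex.Im w * complex.Im z
    <= normc w * normc z.
  have <- : normc (conjc w) = normc w by case: w => x y /=; rewrite sqrrN.
  rewrite -normcM (le_trans _ (normr_Re_le _)) // (le_trans _ (ler_norm _)) //.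
  by case: w z => x y [u v] /=; rewrite mulNr opprK.
move=> [iR iI] ih fh; set I := cintegral mu f.
have [I0|I0] := eqVneq (normc I) 0.
  by rewrite I0; apply: Rintegral_ge0 => x _; exact: le_trans (normc_ge0 _) (fh x).
have Igt0 : 0 < normc I by rewrite lt_neqAle eq_sym I0 normc_ge0.
rewrite -(ler_pM2l Igt0) -expr2 normc_sqrtE sqr_sqrtr ?addr_ge0 ?sqr_ge0 // -normc_sqrtE.
rewrite !expr2 {2 4}/I /cintegral /= -!RintegralZl // -RintegralD //; last 2 first.
- exact: (integrableZl measurableT _ iR).
- exact: (integrableZl measurableT _ iI).
apply: le_Rintegral => //.
- rewrite (_ : _ \o _ = (fun x => (complex.Re I)%:E * (complex.Re (f x))%:E +
    (complex.Im I)%:E * (complex.Im (f x))%:E)%E) //.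
  by apply: integrableD => //; apply: integrableZl.
- rewrite (_ : _ \o _ = (fun x => (normc I)%:E * (h x)%:E)%E) //.
  exact: integrableZl.
- move=> x _.
  exact: le_trans (cs I (f x)) (ler_wpM2l (normc_ge0 I) (fh x)).
Qed.

(** The two integrals of a commutator merge into one because each of them
    converges; a divergent integral is given a value without being linear. *)
Lemma cintegral_commutator (c : R[i]) (f g : V -> R[i]) :
  cintegrable f -> cintegrable g ->
  cintegrable (fun x => c * f x - g x) /\
  c * cintegral mu f - cintegral mu g = cintegral mu (fun x => c * f x - g x).
Proof.
case: c => a b [fR fI] [gR gI].
have ReE x : complex.Re ((a +i* b)%C * f x - g x) =
    a * complex.Re (f x) - b * complex.Im (f x) - complex.Re (g x).
  by case: (f x) => u v; case: (g x).
have ImE x : complex.Im ((a +i* b)%C * f x - g x) =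
    a * complex.Im (f x) + b * complex.Re (f x) - complex.Im (g x).
  by case: (f x) => u v; case: (g x).
have Z (k : R) (u : Qpn pp n -> R) : mu.-integrable setT (EFin \o u) ->
    mu.-integrable setT (EFin \o (fun x => k * u x)).
  move=> iu; rewrite (_ : _ \o _ = (fun x => k%:E * (u x)%:E)%E) //.
  exact: integrableZl.
have B (u v : Qpn pp n -> R) : mu.-integrable setT (EFin \o u) ->
    mu.-integrable setT (EFin \o v) ->
    mu.-integrable setT (EFin \o (fun x => u x - v x)).
  move=> iu iv; rewrite (_ : _ \o _ = (fun x => (u x)%:E - (v x)%:E)%E) //.
  exact: integrableB.
have D (u v : Qpn pp n -> R) : mu.-integrable setT (EFin \o u) ->
    mu.-integrable setT (EFin \o v) ->
    mu.-integrable setT (EFin \o (fun x => u x + v x)).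
  move=> iu iv; rewrite (_ : _ \o _ = (fun x => (u x)%:E + (v x)%:E)%E) //.
  exact: integrableD.
rewrite /cintegrable /cintegral (funext ReE) (funext ImE); split.
  by split; apply: (B) => //; [apply: (B)|apply: (D)]; apply: Z.
rewrite !RintegralB //; try by do ?[apply: (B)|apply: (D)]; try apply: Z.
rewrite RintegralD //; try by apply: Z.
by rewrite !RintegralZl.
Qed.

End ComplexIntegral.

(** * Lipschitz functions *)

Section Lipschitz.
Variables (R : realType) (p : nat) (pp : prime p) (n : nat).
Hypothesis n_gt0 : (0 < n)%N.
Local Notation V := 'rV[Qp pp]_n.

Lemma rnorm_ge0 (x : V) : 0 <= rnorm R x.
Proof. by rewrite /rnorm ler0q pnorm_ge0. Qed.

Lemma lip_norm_ge0 (delta : R) (b : V -> R[i]) : (0 <= lip_norm delta b)%E.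
Proof.
pose h : V := \row_j 1; have h0 : h != 0.
  apply/eqP => /rowP /(_ (Ordinal n_gt0)); rewrite !mxE => /eqP.
  by rewrite oner_eq0.
apply: le_trans (ereal_sup_ubound _); last by exists 0, h; split.
by rewrite lee_fin divr_ge0 ?normc_ge0 ?powR_ge0.
Qed.

Lemma normc_lip (delta : R) (b : V -> R[i]) x y : 0 < delta ->
  lip_space delta b ->
  normc (b x - b y) <= fine (lip_norm delta b) * rnorm R (x - y) `^ delta.
Proof.
move=> d0 bL; have [->|xy] := eqVneq x y.
  rewrite !subrr normc0 mulr_ge0 ?powR_ge0 // fine_ge0 //.
  exact: lip_norm_ge0.
have xy0 : x - y != 0 by rewrite subr_eq0.
have r0 : 0 < rnorm R (x - y) `^ delta by rewrite powR_gt0 // /rnorm ltr0q pnorm_gt0.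
rewrite -ler_pdivrMr // -lee_fin fineK; last first.
  by rewrite ge0_fin_numE ?lip_norm_ge0.
apply: ereal_sup_ubound; exists y, (x - y); split=> //.
by rewrite subrKC.
Qed.

(** Rays have open preimages: if [a < u x], then [u] stays above [a] on the ball
    around [x] of radius [((u x - a) / (L + 1)) ^ (1 / delta)]. *)
Lemma measurable_holder (u : V -> R) (delta L : R) : 0 < delta -> 0 <= L ->
  (forall x y, `|u y - u x| <= L * rnorm R (y - x) `^ delta) ->
  measurable_fun setT (u : Qpn pp n -> R).
Proof.
move=> d0 L0 uL.
apply: (measurability _ (RGenOInfty.measurableE R)) => _ [_ [a ->] <-].
rewrite setTI; apply: measurable_Qpn_open => x; rewrite /= in_itv /= andbT => ax.
pose e := ((u x - a) / (L + 1)) `^ delta^-1.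
have L1 : 0 < L + 1 by rewrite ltr_wpDl.
have q0 : 0 < (u x - a) / (L + 1) by rewrite divr_gt0 // subr_gt0.
have e0 : 0 < e by rewrite powR_gt0.
have [c /andP[c0 ce]] : exists c : rat, 0 < (ratr c : R) < e.
  have [c] := rat_in_itvoo e0; rewrite in_itv => h; by exists c.
exists c => [|y yx]; first by rewrite -(ltr0q R).
rewrite /= in_itv /= andbT.
have : `|u y - u x| < u x - a.
  rewrite (le_lt_trans (uL x y)) //.
  have h : rnorm R (y - x) `^ delta <= (u x - a) / (L + 1).
    have <- : e `^ delta = (u x - a) / (L + 1).
      by rewrite /e -powRrM mulVf ?lt0r_neq0 // powRr1 // ltW.
    rewrite ge0_ler_powR ?nnegrE ?rnorm_ge0 ?(ltW d0) ?(ltW e0) //.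
    by rewrite (le_trans _ (ltW ce)) // /rnorm ler_rat ltW.
  rewrite (le_lt_trans (ler_wpM2l L0 h)) // mulrA ltr_pdivrMr // mulrC.
  by rewrite ltr_pM2l ?subr_gt0 // ltrDl.
by rewrite ltr_norml => /andP[+ _]; lra.
Qed.

Lemma cmeasurable_lip (delta : R) (b : V -> R[i]) : 0 < delta ->
  lip_space delta b -> cmeasurable b.
Proof.
move=> d0 bL; have L0 := fine_ge0 (lip_norm_ge0 delta b).
split; apply: (measurable_holder d0 L0) => x y;
  apply: le_trans (normc_lip _ _ d0 bL).
  rewrite (_ : _ - _ = complex.Re (b y - b x)) ?normr_Re_le //.
  by case: (b y); case: (b x).
rewrite (_ : _ - _ = complex.Im (b y - b x)) ?normr_Im_le //.
by case: (b y); case: (b x).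
Qed.

End Lipschitz.

(** * Power weights and the weak-type bound *)

Section PowerWeights.
Variables (R : realType) (p : nat) (pp : prime p) (n : nat).
Hypothesis n_gt0 : (0 < n)%N.
Local Notation V := 'rV[Qp pp]_n.
Local Notation P := (p%:R : R).

Lemma natr_prime_gt1 : 1 < P.
Proof. by rewrite ltr1n prime_gt1. Qed.

Lemma natr_prime_gt0 : 0 < P.
Proof. by rewrite ltr0n prime_gt0. Qed.

Lemma rnorm_psphere (k : int) (x : V) : @psphere p pp n k x ->
  rnorm R x = P `^ k%:~R.
Proof.
move=> xk; rewrite /rnorm xk powR_intmul ?ler0n //.
by case: k {xk} => k; rewrite ?NegzE -?exprnN ?fmorphV rmorphXn /= ratr_nat.
Qed.

Lemma rnorm0 : rnorm R (0 : V) = 0.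
Proof. by rewrite /rnorm pnorm0 rmorph0. Qed.

Lemma psphere_neq0 k (x : V) : @psphere p pp n k x -> x != 0.
Proof.
move=> xk; rewrite -pnorm_gt0 xk exprz_gt0 //.
by rewrite ltr0n prime_gt0.
Qed.

Lemma exists_psphere (x : V) : x != 0 -> exists k, @psphere p pp n k x.
Proof. by move=> /pnorm_pow. Qed.

Lemma psphere_inj k l (x : V) : @psphere p pp n k x -> @psphere p pp n l x -> k = l.
Proof. by rewrite /psphere /= => -> /(pexpz_inj pp). Qed.

Lemma measurable_rnorm_comp (g : R -> R) :
  measurable_fun setT ((fun x => g (rnorm R x)) : Qpn pp n -> R).
Proof. exact: (@measurable_radial p pp n _ _ (fun c => g (ratr c))). Qed.

Variable mu : {measure set (Qpn pp n) -> \bar R}.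
Hypothesis mu_haar : normalized_haar mu.

Lemma integral_psphere k (f : V -> \bar R) (c : R) :
  (forall x, @psphere p pp n k x -> f x = c%:E) ->
  (\int[mu]_(x in @psphere p pp n k) f x =
   (c * ((1 - P `^ (- n%:R)) * P `^ (k%:~R * n%:R)))%:E)%E.
Proof.
move=> fc; rewrite (eq_integral (cst c%:E)) => [|x /set_mem /fc ->] //.
rewrite integral_cst; last exact: measurable_psphere.
by rewrite EFinM -(haar_psphere mu_haar).
Qed.

(** The weight at the origin is [0 `^ a], which equals [1] when [a = 0]; the
    origin has to be discarded as a null set. *)
Lemma pow_weight_null (a : R) :
  (\int[mu]_(x in [set (0%R : V)]) (pow_weight a x)%:E = 0)%E.
Proof.
rewrite (eq_integral (cst (pow_weight a (0 : V))%:E)); last by move=> x /set_mem ->.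
rewrite integral_cst; last exact: measurable_zero_set.
by rewrite haar_set0 ?mule0.
Qed.

(** The spheres of radius [p ^ (K - i)] contribute a geometric series of ratio
    [p ^ - (n + a)]; its convergence is what [- n < a] is for. *)
Lemma integral_pow_weight_pball a (K : int) : - n%:R < a ->
  (\int[mu]_(x in @pball p pp n K) (pow_weight a x)%:E <=
   ((1 - P `^ (- n%:R)) / (1 - P `^ (- (n%:R + a))) *
    P `^ (K%:~R * (n%:R + a)))%:E)%E.
Proof.
move=> na; have s0 : 0 < n%:R + a by lra.
have P1 := natr_prime_gt1; have P0 := natr_prime_gt0.
pose F i := @psphere p pp n (K - i%:Z).
have ballE : @pball p pp n K = [set 0] `|` \bigcup_i F i.
  apply/seteqP; split => x.
    move=> xK; have [->|x0] := eqVneq x 0; first by left.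
    have [k xk] := exists_psphere x0; right; exists `|K - k|%N => //.
    move: xK; rewrite /pball /= xk ler_pexpz // => kK.
    by rewrite /F (_ : K - `|K - k|%N%:Z = k) //; lia.
  case=> [->|[i _]]; first by rewrite /pball /= pnorm0 exprz_ge0 ?ler0n.
  by rewrite /F /psphere /pball /= => ->; rewrite ler_pexpz //; lia.
have mF i : measurable (F i) by exact: measurable_psphere.
have m0 := @measurable_zero_set p pp n.
have mw : measurable_fun setT (fun x : Qpn pp n => (pow_weight a x)%:E).
  apply/measurable_EFinP; exact: (measurable_rnorm_comp (@powR R ^~ a)).
have w0 (x : Qpn pp n) : (0 <= (pow_weight a x)%:E)%E by rewrite lee_fin powR_ge0.
rewrite ballE ge0_integral_setU //; last 3 first.
- exact: bigcup_measurable.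
- exact: measurable_funTS.
- apply/disj_setPS => x [->] [i _ /psphere_neq0]; by rewrite eqxx.
rewrite [X in (X + _)%E]pow_weight_null add0e ge0_integral_bigcup //; last 2 first.
- exact: measurable_funTS.
- move=> i j _ _ [x [xi xj]]; have := psphere_inj xi xj; lia.
pose z := P `^ (- (n%:R + a)).
have z0 : 0 < z by rewrite powR_gt0.
have z1 : `|z| < 1 by rewrite gtr0_norm // -subr_gt0 subr_powR_gt0 //; lra.
pose c := (1 - P `^ (- n%:R)) * P `^ (K%:~R * (n%:R + a)).
have c0 : 0 <= c.
  by rewrite mulr_ge0 ?powR_ge0 // ltW // subr_powR_gt0 // oppr_lt0 ltr0n.
have FE i : (\int[mu]_(x in F i) (pow_weight a x)%:E = (geometric c z i)%:E)%E.
  rewrite (@integral_psphere _ _ (P `^ ((K - i%:Z)%:~R * a))); last first.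
    by move=> x /rnorm_psphere; rewrite /pow_weight => ->; rewrite -powRrM.
  congr EFin; rewrite /geometric /= -powR_mulrn ?powR_ge0 // -powRrM.
  rewrite /c mulrCA -mulrA -!powRD_gt0 //; congr (_ * _ `^ _).
  by rewrite intrB pmulrn; ring.
rewrite (eq_eseriesr (fun i _ => FE i)).
apply: lime_le.
  by apply: is_cvg_nneseries => i _ _; rewrite lee_fin mulr_ge0 ?exprn_ge0 // ltW.
apply: nearW => N; rewrite sumEFin lee_fin.
by have := geometric_le_lim N c0 z0 z1; rewrite /series /= mulrAC.
Qed.

(** If [|g x| <= M |x| ^ (- s / r)] with [s = n + a], then [|g x| > l] forces
    [|x| < rho] for the [rho] with [l = M rho ^ (- s / r)], and a ball of radius
    [rho] has weight at most a constant times [rho ^ s]. *)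
Lemma weak_wLr_norm_le (r a M : R) (g : V -> R[i]) :
  0 < r -> - n%:R < a -> 0 <= M ->
  (forall x, x != 0 -> normc (g x) <= M * rnorm R x `^ (- ((n%:R + a) / r))) ->
  (weak_wLr_norm mu r (pow_weight a) g <=
   (M * ((1 - P `^ (- n%:R)) / (1 - P `^ (- (n%:R + a)))) `^ r^-1)%:E)%E.
Proof.
move=> r0 na M0 gM; apply: ge_ereal_sup => _ [l l0 ->].
have s0 : 0 < n%:R + a by lra.
have P1 := natr_prime_gt1; have P0 := natr_prime_gt0.
have ri0 : r^-1 != 0 by rewrite invr_eq0 gt_eqF.
pose A := [set y : V | l < normc (g y)]; rewrite -/A.
set W := (_ / _)`^ _.
have w0 (x : Qpn pp n) : (0 <= (pow_weight a x)%:E)%E by rewrite lee_fin powR_ge0.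
(* With [M = 0] there is no radius [rho] to speak of: [g] vanishes off [0]. *)
have [M00|Mn0] := eqVneq M 0.
  have A0 : A `<=` [set 0].
    move=> x lx; apply/eqP; apply/negPn/negP => /gM; rewrite M00 mul0r leNgt.
    by rewrite (lt_trans l0 lx).
  have -> : (\int[mu]_(x in A) (pow_weight a x)%:E = 0)%E.
    apply/eqP; rewrite eq_le integral_ge0 // andbT -(pow_weight_null a).
    exact: (ge0_subset_integral_gen mu A0).
  by rewrite poweR0r // mule0 M00 mul0r.
have Mgt0 : 0 < M by rewrite lt_neqAle eq_sym Mn0.
pose rho := (M / l) `^ (r / (n%:R + a)).
have rho0 : 0 < rho by rewrite powR_gt0 // divr_gt0.
have [K /andP[Krho rhoK]] := powR_bracket P1 rho0.
have AK : A `<=` @pball p pp n K.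
  move=> x lx; have [->|x0] := eqVneq x 0.
    by rewrite /pball /= pnorm0 exprz_ge0 ?ler0n.
  have [k xk] := exists_psphere x0; rewrite /pball /= xk ler_pexpz //.
  rewrite leNgt; apply/negP => Kk.
  have rk : rho < rnorm R x.
    rewrite (rnorm_psphere xk) (lt_le_trans rhoK) //.
    by apply: ler_powR; [exact: ltW|rewrite ler_int lezD1].
  have := lt_le_trans lx (gM _ x0); rewrite ltNge => /negP; apply.
  rewrite powRN -ler_pdivlMl // -[leRHS]invrK lef_pV2 ?posrE ?powR_gt0 //; last 2 first.
  - exact: lt_trans rk.
  - by rewrite invr_gt0 mulr_gt0 ?invr_gt0.
  rewrite invfM invrK mulrC.
  have -> : l^-1 * M = rho `^ ((n%:R + a) / r).
    rewrite /rho -powRrM mulrC [X in _ `^ X](_ : _ = 1) ?powRr1 //.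
    - by rewrite ltW // mulr_gt0 ?invr_gt0.
    - by field; rewrite ?gt_eqF.
  by rewrite ge0_ler_powR ?nnegrE ?rnorm_ge0 ?ltW // divr_gt0.
set c := (1 - _) / _ in W *.
have c0 : 0 <= c.
  rewrite divr_ge0 // ltW // subr_powR_gt0 //; last by lra.
  by rewrite oppr_lt0 ltr0n.
have IA : (\int[mu]_(x in A) (pow_weight a x)%:E <= (c * rho `^ (n%:R + a))%:E)%E.
  apply: le_trans (ge0_subset_integral_gen mu AK w0) _.
  apply: le_trans (integral_pow_weight_pball K na) _.
  rewrite lee_fin ler_wpM2l // powRrM.
  by rewrite ge0_ler_powR ?nnegrE ?powR_ge0 ?(ltW s0) ?(ltW rho0).
apply: (@le_trans _ _ (l%:E * ((c * rho `^ (n%:R + a))%:E `^ r^-1))%E).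
  rewrite lee_pmul2l // gt0_ler_poweR ?invr_ge0 ?(ltW r0) //.
  - by rewrite in_itv /= integral_ge0 // leey.
  - by rewrite in_itv /= leey andbT lee_fin mulr_ge0 ?powR_ge0.
rewrite poweR_EFin lee_fin powRM ?powR_ge0 // -!powRrM.
have -> : r / (n%:R + a) * ((n%:R + a) * r^-1) = 1 by field; rewrite ?gt_eqF.
rewrite powRr1 ?divr_ge0 ?(ltW l0) // le_eqVlt; apply/orP; left; apply/eqP.
by rewrite -/W; field; rewrite gt_eqF.
Qed.

End PowerWeights.

(** * The norm of the kernel against an integral over the half-line *)

Section KernelNorm.
Variables (R : realType) (p : nat) (pp : prime p) (n : nat).
Hypothesis n_gt0 : (0 < n)%N.
Local Notation V := 'rV[Qp pp]_n.
Local Notation P := (p%:R : R).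

(** The interval matched with the sphere [|y| = |x| / P ^ j]; the function [psi]
    will be constant on it. *)
Definition geom_itv (j : int) : set R := `[P `^ j%:~R, P `^ (j + 1)%:~R[%classic.

Lemma geom_itvE (j : int) t :
  geom_itv j t = (P `^ j%:~R <= t < P `^ (j + 1)%:~R) :> Prop.
Proof. by rewrite /geom_itv /= in_itv. Qed.

Lemma bigcup_geom_itv : \bigcup_j geom_itv j = `]0, +oo[%classic.
Proof.
apply/seteqP; split => t.
  move=> [j _]; rewrite geom_itvE /= in_itv /= andbT => /andP[+ _].
  by apply: lt_le_trans; rewrite powR_gt0 // natr_prime_gt0.
rewrite /= in_itv /= andbT => /(powR_bracket (natr_prime_gt1 R pp))[j jt].
by exists j => //; rewrite geom_itvE.
Qed.

Lemma trivIset_geom_itv : trivIset setT geom_itv.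
Proof.
move=> i j _ _ [t []]; rewrite !geom_itvE => /andP[i1 i2] /andP[j1 j2].
have := le_lt_trans i1 j2; have := le_lt_trans j1 i2.
by rewrite !ltr_powR ?natr_prime_gt1 // !ltr_int; lia.
Qed.

Variables (alpha beta delta q q' : R).
Hypotheses (d0 : 0 < delta) (q1 : 1 < q) (qq' : q^-1 + q'^-1 = 1).
Hypothesis beta_n : beta < n%:R.

Lemma conjugate_gt0 : 0 < q'.
Proof.
have q0 : 0 < q by exact: lt_trans q1.
rewrite -invr_gt0; have -> : q'^-1 = 1 - q^-1 by rewrite -qq'; ring.
by rewrite subr_gt0 invf_lt1.
Qed.

(** The integrand of [K3]. *)
Definition psi_density (psi : R -> R[i]) (t : R) : R :=
  normc (psi t) `^ q' * t `^ ((q' - 1) * (n%:R + alpha) - beta * q' - 1) *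
  Num.max 1 (t `^ (- (delta * q'))).

Local Notation e := ((q' - 1) * (n%:R + alpha) - beta * q').

(** On [geom_itv j] the factor [t `^ (e - 1)] loses at most [P `^ (- `|e - 1|)]
    with respect to its value at [P ^ j], the maximum loses at most
    [P `^ (- (delta * q'))], and the length of the interval is [P ^ j * (P - 1)]. *)
Definition density_loss : R := P `^ (- `|e - 1| - delta * q') * (P - 1).

Lemma density_loss_gt0 : 0 < density_loss.
Proof.
by rewrite mulr_gt0 ?powR_gt0 ?subr_gt0 ?natr_prime_gt0 ?natr_prime_gt1.
Qed.

Variable psi : R -> R[i].
Hypothesis psi_step : padic_step p psi.

Lemma psi_stepE (j : int) t : geom_itv j t -> psi t = psi (P `^ j%:~R).
Proof.
rewrite geom_itvE !powR_intmul ?ler0n // => jt.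
by rewrite (psi_step jt).
Qed.

Lemma measurable_geom_itv j : measurable (geom_itv j).
Proof. exact: measurable_itv. Qed.

Lemma measurable_psi_density :
  measurable_fun (\bigcup_j geom_itv j) (fun t => (psi_density psi t)%:E).
Proof.
apply: measurable_fun_bigcup_countable => j; first exact: measurable_geom_itv.
apply/measurable_EFinP.
apply: (@eq_measurable_fun _ _ _ _ _ (fun t => normc (psi (P `^ j%:~R)) `^ q' *
    t `^ (e - 1) * Num.max 1 (t `^ (- (delta * q'))))).
  by move=> t /set_mem jt; rewrite /psi_density (psi_stepE jt).
apply: measurable_funTS; apply: measurable_funM.
  by apply: measurable_funM => //; exact: measurable_powR.
by apply: measurable_maxr => //; exact: measurable_powR.
Qed.

Lemma psi_density_ge0 t : 0 <= psi_density psi t.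
Proof. by rewrite !mulr_ge0 ?powR_ge0 // le_max ler01. Qed.

(** The integrand is bounded below by a constant on [geom_itv j], through
    [powR_bracket_ge] and [max_bracket_ge]. *)
Lemma integral_psi_density_ge (j : int) :
  ((density_loss * (normc (psi (P `^ j%:~R)) `^ q' *
     P `^ (j%:~R * e + Num.max 0 (- j%:~R) * (delta * q'))))%:E <=
   \int[lebesgue_measure]_(t in geom_itv j) (psi_density psi t)%:E)%E.
Proof.
have P1 := natr_prime_gt1 R pp; have P0 := natr_prime_gt0 R pp.
set N := normc _; set w := delta * q'; set m := Num.max _ _.
have w0 : 0 <= w by rewrite mulr_ge0 // ltW // conjugate_gt0.
pose c := N `^ q' * P `^ (j%:~R * (e - 1) - `|e - 1|) * P `^ (m * w - w).
have len : lebesgue_measure (geom_itv j) = (P `^ j%:~R * (P - 1))%:E.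
  rewrite /geom_itv lebesgue_measure_itv /= lte_fin ltr_powR // ltr_int ltrDl.
  rewrite ltr01 -EFinB; congr EFin.
  by rewrite intrD powRD_gt0 // powRr1 ?ltW //; ring.
have -> : density_loss * (N `^ q' * P `^ (j%:~R * e + m * w)) =
    c * (P `^ j%:~R * (P - 1)).
  rewrite /density_loss /c -/w.
  have -> : P `^ (- `|e - 1| - w) * (P - 1) * (N `^ q' * P `^ (j%:~R * e + m * w)) =
      N `^ q' * (P - 1) * (P `^ (- `|e - 1| - w) * P `^ (j%:~R * e + m * w)).
    by ring.
  have -> : N `^ q' * P `^ (j%:~R * (e - 1) - `|e - 1|) * P `^ (m * w - w) *
      (P `^ j%:~R * (P - 1)) = N `^ q' * (P - 1) *
      (P `^ (j%:~R * (e - 1) - `|e - 1|) * P `^ (m * w - w) * P `^ j%:~R).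
    by ring.
  by rewrite -!powRD_gt0 //; congr (_ * _ `^ _); ring.
rewrite EFinM -len -(integral_cst lebesgue_measure (measurable_geom_itv j)).
apply: ge0_le_integral => //.
- exact: measurable_geom_itv.
- by move=> t _; rewrite /= lee_fin !mulr_ge0 ?powR_ge0.
- apply: measurable_funS measurable_psi_density; last by move=> t jt; exists j.
  by rewrite bigcup_geom_itv; exact: measurable_itv.
- move=> t jt; rewrite /= lee_fin /psi_density (psi_stepE jt) -/N -/w.
  move: jt; rewrite geom_itvE => jt.
  apply: ler_pM; rewrite ?mulr_ge0 ?powR_ge0 //; last exact: max_bracket_ge.
  rewrite ler_wpM2l ?powR_ge0 //; apply: powR_bracket_ge => //.
  by move: jt; rewrite intrD.
Qed.


Variable mu : {measure set (Qpn pp n) -> \bar R}.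
Hypothesis mu_haar : normalized_haar mu.
Variable Phi : V -> R[i].
Hypothesis Phi_radial : forall x, x != 0 -> Phi x = psi (rnorm R x).

Definition hkernel (x y : V) : R[i] :=
  Phi (ratr (pnorm y) *: x) / real_complex R (rnorm R y `^ (n%:R - beta)).

Lemma cmeasurable_hkernel x : cmeasurable (hkernel x).
Proof.
pose k (c : rat) : R[i] :=
  Phi (ratr c *: x) / real_complex R ((ratr c : R) `^ (n%:R - beta)).
split; first exact: (@measurable_radial p pp n _ _ (fun c => complex.Re (k c))).
exact: (@measurable_radial p pp n _ _ (fun c => complex.Im (k c))).
Qed.

Lemma normc_real (u : R) : 0 <= u -> normc (real_complex R u) = u.
Proof. by move=> u0; rewrite normc_sqrtE /= expr0n addr0 sqrtr_sqr ger0_norm. Qed.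

(** The denominator is [0 `^ (n - beta)], which is zero, and so is a quotient by
    zero: the origin drops out whatever [Phi 0] is. *)
Lemma hkernel0 x : hkernel x 0 = 0.
Proof.
rewrite /hkernel rnorm0 powR0; last by rewrite gt_eqF // subr_gt0.
by rewrite invr0 mulr0.
Qed.

Lemma scale_psphere (i j : int) (x y : V) : psphere i x -> psphere j y ->
  @psphere p pp n (i - j) (ratr (pnorm y) *: x).
Proof.
rewrite /psphere /= pnormZ => -> ->; rewrite padic_abs_ratr_pow //.
by rewrite -expfzDr ?pnatr_eq0 -?lt0n ?prime_gt0 // addrC.
Qed.

Lemma normc_hkernel (m j : int) (x y : V) : psphere m x -> psphere (m - j) y ->
  normc (hkernel x y) =
  normc (psi (P `^ j%:~R)) * P `^ (- ((m - j)%:~R * (n%:R - beta))).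
Proof.
move=> xm yj; have h := scale_psphere xm yj.
rewrite /hkernel Phi_radial ?(psphere_neq0 h) // (rnorm_psphere R h).
rewrite normcM normcV normc_real ?powR_ge0 // (rnorm_psphere R yj) -powRrM powRN.
by rewrite subKr.
Qed.

(** The ultrametric bound for [|x - y|]; unlike [|x - y|], it is a function of the
    two norms. *)
Definition maxnorm (x y : V) : R := Num.max (rnorm R x) (rnorm R y).

Lemma maxnorm_psphere (m j : int) (x y : V) : psphere m x -> psphere (m - j) y ->
  maxnorm x y = P `^ (m%:~R + Num.max 0 (- j%:~R)).
Proof.
move=> xm yj; rewrite /maxnorm (rnorm_psphere R xm) (rnorm_psphere R yj) intrB.
have P1 := natr_prime_gt1 R pp.
have [j0|j0] := leP 0 j.
  rewrite max_l; last by apply: ler_powR; [exact: ltW|rewrite gerBl ler0z].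
  by rewrite max_l ?addr0 // oppr_le0 ler0z.
rewrite max_r; last by apply: ler_powR; [exact: ltW|rewrite lerDl oppr_ge0 lerz0 ltW].
by rewrite max_r // oppr_ge0 lerz0 ltW.
Qed.

(** The factor that Hoelder's inequality pairs with [|f y| * |y| ^ (alpha / q)],
    once [|b x - b y|] is replaced by its bound. *)
Definition weighted_kernel (x y : V) : R :=
  normc (hkernel x y) * maxnorm x y `^ delta * rnorm R y `^ (- (alpha / q)).

Lemma weighted_kernel_ge0 x y : 0 <= weighted_kernel x y.
Proof. by rewrite !mulr_ge0 ?powR_ge0 ?normc_ge0. Qed.

Lemma measurable_weighted_kernel x :
  measurable_fun setT (weighted_kernel x : Qpn pp n -> R).
Proof.
apply: measurable_funM.
  apply: measurable_funM; first exact: (measurable_normc (cmeasurable_hkernel x)).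
  exact: (@measurable_rnorm_comp R p pp n (fun r => Num.max (rnorm R x) r `^ delta)).
exact: (@measurable_rnorm_comp R p pp n (fun r => r `^ (- (alpha / q)))).
Qed.

(** The degree of homogeneity in [|x|] of the [L ^ q'] norm of the weighted
    kernel. *)
Definition kernel_exponent : R := (beta + delta) - (n%:R + alpha) / q.

(** The exponents of [P] match because [q' / q = q' - 1]; this is the change of
    variable [t = |x| / |y|], under which the sphere of radius [P ^ (m - j)]
    corresponds to [t = P ^ j]. *)
Lemma integral_weighted_kernel_psphere (m j : int) (x : V) : psphere m x ->
  (\int[mu]_(y in @psphere p pp n (m - j)) (weighted_kernel x y `^ q')%:E =
   ((1 - P `^ (- n%:R)) * P `^ (m%:~R * kernel_exponent * q') *
    (normc (psi (P `^ j%:~R)) `^ q' *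
     P `^ (j%:~R * e + Num.max 0 (- j%:~R) * (delta * q'))))%:E)%E.
Proof.
move=> xm; have P0 := natr_prime_gt0 R pp.
set N := normc _; set M := Num.max _ _; set mj : R := (m - j)%:~R.
have q0 : 0 < q by exact: lt_trans q1.
have q'0 := conjugate_gt0.
rewrite (@integral_psphere _ _ _ _ _ mu_haar _ _ (N `^ q' *
  P `^ ((- (mj * (n%:R - beta)) + (m%:~R + M) * delta +
          mj * (- (alpha / q))) * q'))); last first.
  move=> y yj; rewrite /weighted_kernel (normc_hkernel xm yj).
  rewrite (maxnorm_psphere xm yj) (rnorm_psphere R yj) -!powRrM -/mj -/M -/N.
  rewrite -!mulrA -!powRD_gt0 // powRM ?powR_ge0 ?normc_ge0 // -powRrM.
  by rewrite addrA.
congr EFin.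
(* Only the total exponents of [P] on both sides have to agree. *)
have key (u v a b c f : R) : a + b = c + f ->
    u * P `^ a * (v * P `^ b) = v * P `^ c * (u * P `^ f).
  move=> h; have -> : u * P `^ a * (v * P `^ b) = u * v * (P `^ a * P `^ b) by ring.
  by rewrite -powRD_gt0 // h powRD_gt0 //; ring.
apply: key; rewrite /kernel_exponent /mj intrB.
have -> : q^-1 = 1 - q'^-1 by rewrite -qq'; ring.
by field; rewrite gt_eqF.
Qed.

(** The spheres miss the origin, where the kernel vanishes; on each of them the
    two sides are compared through their common value [psi (P ^ j)]. *)
Lemma integral_weighted_kernel_le (m : int) (x : V) : psphere m x ->
  (\int[mu]_y (weighted_kernel x y `^ q')%:E <=
   ((1 - P `^ (- n%:R)) / density_loss * P `^ (m%:~R * kernel_exponent * q'))%:E *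
   \int[lebesgue_measure]_(t in `]0%R, +oo[) (psi_density psi t)%:E)%E.
Proof.
move=> xm; have P0 := natr_prime_gt0 R pp; have q'0 := conjugate_gt0.
have c0 : 0 <= 1 - P `^ (- n%:R).
  by rewrite ltW // subr_powR_gt0 ?natr_prime_gt1 // oppr_lt0 ltr0n.
pose S j := @psphere p pp n (m - j).
have mG : measurable_fun setT (fun y : Qpn pp n => (weighted_kernel x y `^ q')%:E).
  apply/measurable_EFinP; apply: (measurableT_comp (measurable_powR q')).
  exact: measurable_weighted_kernel.
have -> : (\int[mu]_y (weighted_kernel x y `^ q')%:E =
    \int[mu]_(y in \bigcup_j S j) (weighted_kernel x y `^ q')%:E)%E.
  rewrite [RHS]integral_mkcond; apply: eq_integral => y _; rewrite patchE.
  case: ifPn => // /negP yS; suff -> : y = 0.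
    by rewrite /weighted_kernel hkernel0 normc0 !mul0r powR0 // gt_eqF.
  apply/eqP; apply/negPn/negP => /exists_psphere[k yk]; apply: yS.
  by rewrite inE; exists (m - k) => //; rewrite /S subKr.
rewrite -bigcup_geom_itv; apply: ge0_integral_partition_le.
- by move=> j; exact: measurable_psphere.
- exact: measurable_geom_itv.
- by move=> i j _ _ [y [yi yj]]; have := psphere_inj yi yj; lia.
- exact: trivIset_geom_itv.
- exact: measurable_funTS.
- exact: measurable_psi_density.
- by move=> y; rewrite lee_fin powR_ge0.
- by move=> t; rewrite lee_fin psi_density_ge0.
move=> j; rewrite [leLHS](integral_weighted_kernel_psphere j xm).
have l0 := density_loss_gt0.
apply: le_trans (lee_wpmul2l _ (integral_psi_density_ge j)); last first.
  by rewrite lee_fin !mulr_ge0 ?powR_ge0 ?invr_ge0 ?(ltW l0).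
rewrite -EFinM lee_fin le_eqVlt; apply/orP; left; apply/eqP.
by field; rewrite gt_eqF.
Qed.

End KernelNorm.

(** * The pointwise bound for the commutator *)

Section Commutator.
Variables (R : realType) (p : nat) (pp : prime p) (n : nat).
Hypothesis n_gt0 : (0 < n)%N.
Local Notation V := 'rV[Qp pp]_n.
Local Notation P := (p%:R : R).
Variables (alpha beta delta q q' : R).
Hypotheses (d0 : 0 < delta) (q1 : 1 < q) (qq' : q^-1 + q'^-1 = 1).
Hypothesis beta_n : beta < n%:R.
Variable psi : R -> R[i].
Hypothesis psi_step : padic_step p psi.
Variable mu : {measure set (Qpn pp n) -> \bar R}.
Hypothesis mu_haar : normalized_haar mu.
Variable Phi : V -> R[i].
Hypothesis Phi_radial : forall x, x != 0 -> Phi x = psi (rnorm R x).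
Variables (b f : V -> R[i]).
Hypotheses (b_lip : lip_space delta b) (f_wLq : wLq mu q (pow_weight alpha) f).

Local Notation hk := (hkernel beta Phi).
Local Notation wk := (weighted_kernel alpha beta delta q Phi).
Local Notation L := (fine (lip_norm delta b)).
Local Notation I :=
  (\int[lebesgue_measure]_(t in `]0%R, +oo[)
     (psi_density n alpha beta delta q' psi t)%:E)%E.
Hypothesis I_fin : (I < +oo)%E.

Let q0 : 0 < q. Proof. exact: lt_trans q1. Qed.
Let q'0 : 0 < q'. Proof. exact: conjugate_gt0 q1 qq'. Qed.

(** The integrand of the commutator is bounded by this function times the Lipschitz
    norm of [b]. *)
Definition majorant (x y : V) : R :=
  normc (hk x y) * maxnorm R x y `^ delta * normc (f y).

Definition weighted_abs (y : V) : R := normc (f y) * rnorm R y `^ (alpha / q).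

Lemma majorantE x y : majorant x y = weighted_abs y * wk x y.
Proof.
have [->|y0] := eqVneq y 0.
  by rewrite /majorant /weighted_kernel hkernel0 // normc0 !mul0r mulr0.
have r0 : 0 < rnorm R y by rewrite /rnorm ltr0q pnorm_gt0.
rewrite /majorant /weighted_abs /weighted_kernel powRN.
by field; rewrite gt_eqF // powR_gt0.
Qed.

Lemma measurable_weighted_abs :
  measurable_fun setT (weighted_abs : Qpn pp n -> R).
Proof.
apply: measurable_funM; first by apply: measurable_normc; case: f_wLq.
exact: (@measurable_rnorm_comp R p pp n (fun r => r `^ (alpha / q))).
Qed.

Lemma measurable_majorant x : measurable_fun setT (majorant x : Qpn pp n -> R).
Proof.
rewrite (funext (majorantE x)); apply: measurable_funM.
  exact: measurable_weighted_abs.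
exact: measurable_weighted_kernel.
Qed.

Lemma majorant_ge0 x y : 0 <= majorant x y.
Proof. by rewrite !mulr_ge0 ?powR_ge0 ?normc_ge0. Qed.

Lemma Lnorm_weighted_abs :
  Lnorm mu q%:E (EFin \o (weighted_abs : Qpn pp n -> R)) =
  wLq_norm mu q (pow_weight alpha) f.
Proof.
rewrite Lnorm.unlock /wLq_norm; congr poweR; apply: eq_integral => y _ /=.
rewrite ger0_norm ?mulr_ge0 ?powR_ge0 ?normc_ge0 //.
rewrite powRM ?powR_ge0 ?normc_ge0 // -powRrM divfK //; exact: lt0r_neq0.
Qed.

Definition kernel_const : R :=
  ((1 - P `^ (- n%:R)) / density_loss p n alpha beta delta q') `^ q'^-1.

(** Hoelder's inequality, with the weight [|y| ^ alpha] shared between the two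
    factors of the integrand. *)
Lemma integral_majorant_le (m : int) (x : V) : psphere m x ->
  (\int[mu]_y (majorant x y)%:E <=
   (fine (wLq_norm mu q (pow_weight alpha) f) *
    (kernel_const * fine (poweR I q'^-1) *
     P `^ (m%:~R * kernel_exponent n alpha beta delta q)))%:E)%E.
Proof.
move=> xm; have P0 := natr_prime_gt0 R pp.
have := hoelder mu measurable_weighted_abs
  (measurable_weighted_kernel alpha beta delta q Phi x) q0 q'0 qq'.
rewrite Lnorm1 Lnorm_weighted_abs.
rewrite (eq_integral (fun y : Qpn pp n => (majorant x y)%:E)); last first.
  by move=> y _ /=; rewrite -majorantE ger0_norm // majorant_ge0.
move=> h; apply: le_trans h _.
have c0 : 0 <= (1 - P `^ (- n%:R)) / density_loss p n alpha beta delta q'.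
  rewrite divr_ge0 ?(ltW (density_loss_gt0 pp _ _ _ _ _)) //.
  by rewrite ltW // subr_powR_gt0 ?natr_prime_gt1 // oppr_lt0 ltr0n.
have I0 : (0 <= I)%E by apply: integral_ge0 => t _; rewrite lee_fin psi_density_ge0.
have Ifin : I \is a fin_num by rewrite ge0_fin_numE.
have N0 : (0 <= wLq_norm mu q (pow_weight alpha) f)%E by exact: poweR_ge0.
have Nfin : wLq_norm mu q (pow_weight alpha) f \is a fin_num.
  by rewrite ge0_fin_numE //; case: f_wLq.
rewrite EFinM fineK // lee_wpmul2l //.
have -> : Lnorm mu q'%:E (EFin \o (wk x : Qpn pp n -> R)) =
    poweR (\int[mu]_y (wk x y `^ q')%:E) q'^-1.
  rewrite Lnorm.unlock; congr poweR; apply: eq_integral => y _ /=.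
  by rewrite ger0_norm // weighted_kernel_ge0.
have := integral_weighted_kernel_le n_gt0 alpha d0 q1 qq' beta_n psi_step mu_haar
  Phi_radial xm.
move=> /(gt0_ler_poweR (r := q'^-1)) h.
apply: le_trans (h _ _ _) _; rewrite ?invr_ge0 ?(ltW q'0) //.
- rewrite in_itv /= leey andbT; apply: integral_ge0 => y _.
  by rewrite lee_fin powR_ge0.
- by rewrite in_itv /= leey andbT mule_ge0 // lee_fin mulr_ge0 ?powR_ge0.
rewrite poweRM ?lee_fin ?(mulr_ge0 c0) ?powR_ge0 //.
rewrite poweR_EFin powRM ?powR_ge0 // -powRrM mulfK ?gt_eqF // -/kernel_const.
rewrite -{1}(fineK Ifin) poweR_EFin -[in X in (_ <= X)%E](fineK Ifin) poweR_EFin /=.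
by rewrite -EFinM lee_fin mulrAC.
Qed.

Lemma maxnorm_ge0 (x y : V) : 0 <= maxnorm R x y.
Proof. by rewrite /maxnorm le_max rnorm_ge0. Qed.

Lemma rnormB_le (x y : V) : rnorm R (x - y) <= maxnorm R x y.
Proof.
rewrite /maxnorm /rnorm le_max !ler_rat -le_max.
exact: pnormB.
Qed.

(** Both integrals of the commutator converge, because [b] is bounded by
    [|b x| + L max(|x|, |y|) ^ delta]; they may be merged into one integral, in
    which [b x - b y] is at most [L max(|x|, |y|) ^ delta]. *)
Lemma normc_commutator_le (m : int) (x : V) : psphere m x ->
  normc (hausdorff_comm mu Phi beta b f x) <=
  L * (fine (wLq_norm mu q (pow_weight alpha) f) *
    (kernel_const * fine (poweR I q'^-1) *
     P `^ (m%:~R * kernel_exponent n alpha beta delta q))).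
Proof.
move=> xm; have P0 := natr_prime_gt0 R pp.
have L0 : 0 <= L by rewrite fine_ge0 // lip_norm_ge0.
have mh := measurable_majorant x.
have ih : mu.-integrable setT (EFin \o (majorant x : Qpn pp n -> R)).
  apply/integrableP; split; first exact/measurable_EFinP.
  apply: le_lt_trans (ltry _); apply: le_trans (integral_majorant_le xm).
  rewrite le_eqVlt; apply/orP; left; apply/eqP; apply: eq_integral => y _ /=.
  by rewrite ger0_norm // majorant_ge0.
have iZ (k : R) : mu.-integrable setT
    (EFin \o ((fun y : V => k * majorant x y) : Qpn pp n -> R)).
  rewrite (_ : _ \o _ = (fun y : Qpn pp n => k%:E * (majorant x y)%:E)%E) //.
  exact: integrableZl.
have fm : cmeasurable f by case: f_wLq.
have bm : cmeasurable b by exact: cmeasurable_lip b_lip.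
pose F y := hk x y * f y; pose G y := hk x y * (b y * f y).
have Fm : cmeasurable F.
  by apply: cmeasurableM => //; exact: cmeasurable_hkernel.
have Gm : cmeasurable G.
  apply: cmeasurableM; first exact: cmeasurable_hkernel.
  exact: cmeasurableM.
pose M := P `^ (m%:~R * delta).
have M0 : 0 < M by rewrite powR_gt0.
(* [max (|x|, |y|) ^ delta] is at least [|x| ^ delta = M > 0]. *)
have FM y : normc (F y) <= M^-1 * majorant x y.
  have MM : M <= maxnorm R x y `^ delta.
    rewrite /M powRrM -(rnorm_psphere R xm).
    by rewrite ge0_ler_powR ?nnegrE ?rnorm_ge0 ?(ltW d0) ?le_max ?rnorm_ge0 ?lexx.
  rewrite ler_pdivlMl // /F /majorant normcM mulrAC [leRHS]mulrC.
  by rewrite ler_wpM2r // mulr_ge0 ?normc_ge0.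
have dist y : normc (b x - b y) <= L * maxnorm R x y `^ delta.
  apply: le_trans (normc_lip n_gt0 _ _ d0 b_lip) _; rewrite ler_wpM2l //.
  by rewrite ge0_ler_powR ?nnegrE ?rnorm_ge0 ?maxnorm_ge0 ?(ltW d0) ?rnormB_le.
have dF y : normc (b x * F y - G y) <= L * majorant x y.
  have -> : b x * F y - G y = (b x - b y) * F y by rewrite /F /G; ring.
  rewrite normcM /F normcM /majorant.
  have -> : L * (normc (hk x y) * maxnorm R x y `^ delta * normc (f y)) =
    L * maxnorm R x y `^ delta * (normc (hk x y) * normc (f y)) by ring.
  by rewrite ler_wpM2r ?dist // mulr_ge0 ?normc_ge0.
have Fi : cintegrable mu F by exact: le_cintegrable (iZ M^-1) FM.
have Gi : cintegrable mu G.
  apply: (le_cintegrable Gm (iZ (normc (b x) * M^-1 + L))) => y.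
  have -> : G y = b x * F y + - (b x * F y - G y) by ring.
  rewrite (le_trans (le_normcD _ _)) // normcN mulrDl lerD // normcM -mulrA.
  by rewrite ler_wpM2l ?normc_ge0.
have [Hi HE] := cintegral_commutator (b x) Fi Gi.
have -> : hausdorff_comm mu Phi beta b f x = cintegral mu (fun y => b x * F y - G y).
  exact: HE.
apply: le_trans (normc_cintegral_le Hi (iZ L) dF) _.
rewrite RintegralZl // ler_wpM2l // -lee_fin /Rintegral fineK.
  exact: integral_majorant_le.
exact: integrable_fin_num.
Qed.

End Commutator.

(** * The weak-type estimate *)

Theorem theorem5p1 (R : realType) (p : nat) (pp : prime p) (n : nat)
    (hn : (1 <= n)%N) (alpha beta gamma delta q q' r : R)
    (hbeta : 0 <= beta < n%:R) (hq : 1 < q) (hqr : q < r)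
    (hdelta : 0 < delta < 1) (hag : - n%:R < Num.min alpha gamma)
    (hbal : (beta + delta) - (n%:R + alpha) / q = - ((n%:R + gamma) / r))
    (hq' : q^-1 + q'^-1 = 1) :
  exists2 C : R, 0 < C &
    forall (mu : {measure set (Qpn pp n) -> \bar R}), normalized_haar mu ->
    forall (psi : R -> R[i]), padic_step p psi ->
    forall (Phi : 'rV[Qp pp]_n -> R[i]),
      (forall x, x != 0 -> Phi x = psi (rnorm R x)) ->
    forall (b : 'rV[Qp pp]_n -> R[i]), lip_space delta b ->
    (K3 n alpha beta delta q' C psi < +oo)%E ->
    forall (f : 'rV[Qp pp]_n -> R[i]),
      wLq mu q (pow_weight alpha) f ->
      (weak_wLr_norm mu r (pow_weight gamma)
         (hausdorff_comm mu Phi beta b f)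
       <= K4 alpha beta gamma delta r q' C psi b *
          wLq_norm mu q (pow_weight alpha) f)%E.
Proof.
have P1 := natr_prime_gt1 R pp; have P0 := natr_prime_gt0 R pp.
have [b0 bn] := andP hbeta; have [d0 d1] := andP hdelta.
have q'0 : 0 < q' := conjugate_gt0 hq hq'.
have r0 : 0 < r by lra.
have gn : - n%:R < gamma by move: hag; rewrite lt_min => /andP[].
have l0 := density_loss_gt0 pp n alpha beta delta q'.
have c0 : 0 < 1 - p%:R `^ (- n%:R) :> R.
  by rewrite subr_powR_gt0 // oppr_lt0 ltr0n.
pose kc : R := kernel_const p n alpha beta delta q'.
have kc0 : 0 < kc by rewrite powR_gt0 // divr_gt0.
(* [K4] carries a factor [1 - p ^ - n], which [C] has to cancel. *)
exists (kc / (1 - p%:R `^ (- n%:R))); first by rewrite divr_gt0.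
move=> mu mu_haar psi psi_step Phi Phi_radial b b_lip K3_fin f f_wLq.
set C := kc / _.
have C0 : 0 < C by rewrite divr_gt0.
pose I := (\int[lebesgue_measure]_(t in `]0%R, +oo[)
  (psi_density n alpha beta delta q' psi t)%:E)%E.
have K3E : K3 n alpha beta delta q' C psi = (C%:E * poweR I q'^-1)%E by [].
have Ip0 : (0 <= poweR I q'^-1)%E by exact: poweR_ge0.
have Ip_lty : (poweR I q'^-1 < +oo)%E.
  move: K3_fin; rewrite K3E; case: (poweR I q'^-1) Ip0 => [u||] //= _.
    by move=> _; rewrite ltry.
  by rewrite gt0_muley ?lte_fin.
have I_fin : (I < +oo)%E by apply: lty_poweRy Ip_lty; rewrite invr_eq0 gt_eqF.
have Ip_fin : poweR I q'^-1 \is a fin_num by rewrite ge0_fin_numE.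
have N_fin : wLq_norm mu q (pow_weight alpha) f \is a fin_num.
  by rewrite ge0_fin_numE ?poweR_ge0 //; case: f_wLq.
have L_fin : lip_norm delta b \is a fin_num.
  by rewrite ge0_fin_numE // lip_norm_ge0.
rewrite /K4 K3E -(fineK N_fin) -(fineK Ip_fin) -(fineK L_fin) -!EFinM.
set N := fine (wLq_norm _ _ _ _); set J := fine (poweR _ _); set L := fine _.
have N0 : 0 <= N by rewrite fine_ge0 ?poweR_ge0.
have J0 : 0 <= J by rewrite fine_ge0.
have L0 : 0 <= L by rewrite fine_ge0 ?lip_norm_ge0.
have pointwise (x : 'rV[Qp pp]_n) : x != 0 ->
    normc (hausdorff_comm mu Phi beta b f x) <=
    L * (N * (kc * J)) * rnorm R x `^ (- ((n%:R + gamma) / r)).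
  move=> /exists_psphere[m xm].
  have := normc_commutator_le hn d0 hq hq' bn psi_step mu_haar Phi_radial b_lip
    f_wLq I_fin xm.
  by rewrite /kernel_exponent hbal (rnorm_psphere R xm) -powRrM !mulrA.
have M0 : 0 <= L * (N * (kc * J)) by rewrite !mulr_ge0 // ltW.
apply: le_trans (weak_wLr_norm_le hn mu_haar r0 gn M0 pointwise) _.
rewrite lee_fin le_eqVlt; apply/orP; left; apply/eqP.
set W := (_ / _) `^ r^-1.
by rewrite /C; field; rewrite gt_eqF.
Qed.
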